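(* Let $\Gamma$ be a tree lattice of directly split Nagao type, acting on its associated tree $T$, let $G=\mathrm{Aut}(T)$, let $L\leq G$ be the subgroup of all level-preserving automorphisms of $T$, and let $C(\Gamma)$ be the commensurator of $\Gamma$ in $G$. Then $C(\Gamma)\cap L$ is dense in $L$.
   Context: Lattices of Nagao type. Let $R$ be an infinite ray with vertices $x_0,x_1,x_2,\dots$. To each vertex $x_i$ ($i\geq 0$) a finite group $\Gamma_i$ is attached such that $\Gamma_i\leq\Gamma_{i+1}$ for all $i>0$, and a common subgroup $H_0$ of $\Gamma_0$ and $\Gamma_1$ is given. Put $k=[\Gamma_0:H_0]$, $q_0=k-1$, $q_1=[\Gamma_1:H_0]$, $q_i=[\Gamma_i:\Gamma_{i-1}]$ for $i\geq 2$; it is required that $q_i\geq 2$ for all $i\geq 0$. Attach $H_0$ to the edge $\{x_0,x_1\}$ and $\Gamma_i$ to the edge $\{x_i,x_{i+1}\}$ for $i>0$ (with the inclusion maps); this is a graph of groups on $R$. Let $\Gamma$ be its fundamental group and $T$ its Bass–Serre tree, on which $\Gamma$ acts with $R$ as fundamental domain, with $\Gamma_i=\mathrm{Stab}_\Gamma(x_i)$ and $H_0=\mathrm{Stab}_\Gamma(\{x_0,x_1\})$. Let $G=\mathrm{Aut}(T)$, with the topology in which the pointwise fixators of finite subtrees form a basis of open neighborhoods of the identity. The image of $\Gamma$ in $G$ (the kernel is a finite subgroup of $H_0$) is again denoted by $\Gamma$; it is a non-uniform lattice in $G$, called a lattice of Nagao type. Directly split. $\Gamma$ is of directly split Nagao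 type if there exist, for all $j>0$, $H_0$-invariant (i.e. normalized by $H_0$) subgroups $U_j\leq\Gamma_j$ such that $\Gamma_i=H_0\ltimes(U_1\times U_2\times\cdots\times U_i)$ (internal products) for all $i>0$. Level. Each vertex $x$ of $T$ lies in the orbit $\Gamma.x_i$ for exactly one $i\geq0$; this $i$ is the level $\ell(x)$. Put $L=\{g\in G\mid \ell(g.x)=\ell(x)\text{ for all vertices }x\text{ of }T\}$. Commensurator. $C(\Gamma)=\{g\in G\mid \Gamma\cap g\Gamma g^{-1}\text{ has finite index in }\Gamma\text{ and in }g\Gamma g^{-1}\}$. *)

(* Defs.v *)
(* MathComp / MathComp-Analysis. *)
From HB Require Import structures.
From mathcomp Require Import all_boot all_fingroup.

Set Implicit Arguments.
Unset Strict Implicit.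
Unset Printing Implicit Defensive.

Local Open Scope group_scope.

(* A graph of finite groups on the infinite ray x_0, x_1, ...: the edge        *)
(* {x_i, x_(i+1)} carries [egrp i], embedded in the groups of its two ends.    *)
Record ray_of_groups := RayOfGroups {
  vgrp : nat -> finGroupType;
  egrp : nat -> finGroupType;
  src : forall i, {morphism [set: egrp i] >-> vgrp i};
  tgt : forall i, {morphism [set: egrp i] >-> vgrp i.+1};
  src_inj : forall i, 'injm (src i);
  tgt_inj : forall i, 'injm (tgt i)
}.

(* The inclusions H_0 <= Gamma_0, H_0 <= Gamma_1 and Gamma_i <= Gamma_(i+1)    *)
(* (i > 0) are given as embeddings, since the Gamma_i have no common finite    *)
(* overgroup.                                                                  *)
Definition nagao_index (Gam : nat -> finGroupType) (H0 : finGroupType)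
    (H0_in0 : {morphism [set: H0] >-> Gam 0%N}) (H0_in1 : {morphism [set: H0] >-> Gam 1%N})
    (Gam_up : forall i, {morphism [set: Gam i.+1] >-> Gam i.+2}) (i : nat) : nat :=
  match i with
  | 0 => #|[set: Gam 0%N] : H0_in0 @* [set: H0]|.-1
  | 1 => #|[set: Gam 1%N] : H0_in1 @* [set: H0]|
  | j.+2 => #|[set: Gam j.+2] : Gam_up j @* [set: Gam j.+1]|
  end.

Record nagao_data := NagaoData {
  Gam : nat -> finGroupType;
  H0 : finGroupType;
  H0_in0 : {morphism [set: H0] >-> Gam 0%N};
  H0_in1 : {morphism [set: H0] >-> Gam 1%N};
  Gam_up : forall i, {morphism [set: Gam i.+1] >-> Gam i.+2};
  H0_in0_inj : 'injm H0_in0;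
  H0_in1_inj : 'injm H0_in1;
  Gam_up_inj : forall i, 'injm (Gam_up i);
  nagao_index_ge2 : forall i, 2 <= nagao_index H0_in0 H0_in1 Gam_up i
}.

Section NagaoRay.
Variable N : nagao_data.

Definition nagao_egrp (i : nat) : finGroupType :=
  if i is j.+1 then Gam N j.+1 else H0 N.

Definition nagao_src (i : nat) : {morphism [set: nagao_egrp i] >-> Gam N i} :=
  match i with
  | 0 => H0_in0 N
  | j.+1 => idm_morphism [set: Gam N j.+1]
  end.

Definition nagao_tgt (i : nat) : {morphism [set: nagao_egrp i] >-> Gam N i.+1} :=
  match i with
  | 0 => H0_in1 N
  | j.+1 => Gam_up N j
  end.

Lemma nagao_src_inj i : 'injm (nagao_src i).
Proof. by case: i => [|i]; [exact: H0_in0_inj | exact: injm_idm]. Qed.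

Lemma nagao_tgt_inj i : 'injm (nagao_tgt i).
Proof. by case: i => [|i]; [exact: H0_in1_inj | exact: Gam_up_inj]. Qed.

Definition nagao_ray : ray_of_groups := RayOfGroups nagao_src_inj nagao_tgt_inj.

(* Image of H_0 in Gamma_(i+1). *)
Fixpoint H0_image (i : nat) : {set Gam N i.+1} :=
  match i with
  | 0 => H0_in1 N @* [set: H0 N]
  | j.+1 => Gam_up N j @* H0_image j
  end.

(* [U j] is the subgroup written U_(j+1) in mathematical notation;             *)
(* [factor_images U i] lists the images of U_1, ..., U_(i+1) in Gamma_(i+1).   *)
Fixpoint factor_images (U : forall j, {group Gam N j.+1}) (i : nat) :
    seq {set Gam N i.+1} :=
  match i with
  | 0 => [:: U 0 : {set _}]
  | j.+1 => rcons [seq Gam_up N j @* (A : {set _}) | A <- factor_images U j]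
                  (U j.+1 : {set _})
  end.

Definition directly_split : Prop :=
  exists U : forall j, {group Gam N j.+1},
    (forall j, H0_image j \subset 'N(U j)) /\
    (forall i, (\big[dprod/1]_(A <- factor_images U i) A) ><| H0_image i
               = [set: Gam N i.+1]).

End NagaoRay.

From mathcomp Require Import generic_quotient all_classical topology_structure.
From Stdlib Require Import Relation_Operators.

Local Open Scope quotient_scope.
Local Open Scope classical_set_scope.

(* Fundamental group: words in the vertex groups modulo the congruence         *)
(* generated by the vertex group laws and by the identification of the two     *)
(* images of each edge group. The ray is its own maximal subtree, so there     *)
(* are no stable letters.                                                      *)
Section FundamentalGroup.
Variable X : ray_of_groups.

Definition letter := {i : nat & vgrp X i}.
Definition lett i (g : vgrp X i) : letter := existT (fun i => vgrp X i : Type) i g.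

Inductive word_eq : seq letter -> seq letter -> Prop :=
| word_eq_refl u : word_eq u u
| word_eq_sym u v : word_eq u v -> word_eq v u
| word_eq_trans u v w : word_eq u v -> word_eq v w -> word_eq u w
| word_eq_cat u u' v v' :
    word_eq u u' -> word_eq v v' -> word_eq (u ++ v) (u' ++ v')
| word_eq_one i : word_eq [:: lett (1 : vgrp X i)] [::]
| word_eq_mul i (g h : vgrp X i) : word_eq [:: lett g; lett h] [:: lett (g * h)]
| word_eq_edge i (a : egrp X i) : word_eq [:: lett (src X i a)] [:: lett (tgt X i a)].

Definition word_eqb : rel (seq letter) := fun u v => `[< word_eq u v >].

Lemma word_eqb_equiv : equiv_class_of word_eqb.
Proof.
split=> [u|u v|v u w].
- exact/asboolP/word_eq_refl.
- by apply/asboolP/asboolP; exact: word_eq_sym.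
- by move=> /asboolP uv /asboolP vw; apply/asboolP/(word_eq_trans uv vw).
Qed.

Canonical word_equiv := EquivRelPack word_eqb_equiv.

Definition pi1 := {eq_quot word_equiv}.
HB.instance Definition _ := EqQuotient.on pi1.
HB.instance Definition _ := Choice.on pi1.

Definition pi1_word (u : seq letter) : pi1 := \pi_pi1 u.

Lemma pi1_wordP u v : pi1_word u = pi1_word v <-> word_eq u v.
Proof.
by split=> [/eqP|uv]; [rewrite eqmodE => /asboolP | apply/eqP; rewrite eqmodE; apply/asboolP].
Qed.

Lemma pi1_reprK (x : pi1) : pi1_word (repr x) = x.
Proof. exact: reprK. Qed.

Lemma word_eq_repr u : word_eq (repr (pi1_word u)) u.
Proof. by apply/pi1_wordP; exact: pi1_reprK. Qed.

Definition word_inv (u : seq letter) : seq letter :=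
  rev [seq lett (projT2 x : vgrp X (projT1 x))^-1 | x : letter <- u].

Definition pi1_mul (x y : pi1) : pi1 := pi1_word (repr x ++ repr y).
Definition pi1_inv (x : pi1) : pi1 := pi1_word (word_inv (repr x)).

Lemma pi1_mulE u v : pi1_mul (pi1_word u) (pi1_word v) = pi1_word (u ++ v).
Proof. by apply/pi1_wordP/word_eq_cat; exact: word_eq_repr. Qed.

Lemma word_inv_cat u v : word_inv (u ++ v) = word_inv v ++ word_inv u.
Proof. by rewrite /word_inv map_cat rev_cat. Qed.

Lemma word_invK : involutive word_inv.
Proof.
move=> u; rewrite /word_inv map_rev revK -map_comp map_id_in// => -[i g] _ /=.
by rewrite invgK.
Qed.

Lemma word_mulVw u : word_eq (word_inv u ++ u) [::].
Proof.
elim: u => [|[i g] u IH]; first exact: word_eq_refl.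
have -> : word_inv (existT _ i g :: u) ++ existT _ i g :: u =
    word_inv u ++ ([:: lett g^-1; lett g] ++ u).
  by rewrite -cat1s word_inv_cat -catA.
apply: word_eq_trans IH; apply: word_eq_cat; first exact: word_eq_refl.
rewrite -[X in word_eq _ X]cat0s; apply: word_eq_cat; last exact: word_eq_refl.
by apply: word_eq_trans (word_eq_mul _ _) _; rewrite mulVg; exact: word_eq_one.
Qed.

Lemma pi1_mulA : associative pi1_mul.
Proof.
move=> x y z; rewrite -[x]pi1_reprK -[y]pi1_reprK -[z]pi1_reprK.
by rewrite !pi1_mulE catA.
Qed.

Lemma pi1_mul1 : left_id (pi1_word [::]) pi1_mul.
Proof. by move=> x; rewrite -[x]pi1_reprK pi1_mulE. Qed.

Lemma pi1_1mul : right_id (pi1_word [::]) pi1_mul.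
Proof. by move=> x; rewrite -[x]pi1_reprK pi1_mulE cats0. Qed.

Lemma pi1_mulV : left_inverse (pi1_word [::]) pi1_inv pi1_mul.
Proof.
move=> x; rewrite -{2}[x]pi1_reprK pi1_mulE; apply/pi1_wordP; exact: word_mulVw.
Qed.

Lemma pi1_Vmul : right_inverse (pi1_word [::]) pi1_inv pi1_mul.
Proof.
move=> x; rewrite -{1}[x]pi1_reprK pi1_mulE; apply/pi1_wordP.
rewrite -{1}(word_invK (repr x)); exact: word_mulVw.
Qed.

HB.instance Definition _ :=
  isGroup.Build pi1 pi1_mulA pi1_mul1 pi1_1mul pi1_mulV pi1_Vmul.

Definition vmap i (g : vgrp X i) : pi1 := pi1_word [:: lett g].

Lemma vmapM i (g h : vgrp X i) : vmap (g * h) = vmap g * vmap h.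
Proof. by rewrite /vmap [RHS]pi1_mulE; apply/pi1_wordP/word_eq_sym/word_eq_mul. Qed.

Lemma vmap1 i : vmap (1 : vgrp X i) = 1.
Proof. exact/pi1_wordP/word_eq_one. Qed.

Lemma vmap_edge i (a : egrp X i) : vmap (src X i a) = vmap (tgt X i a).
Proof. exact/pi1_wordP/word_eq_edge. Qed.

End FundamentalGroup.

(* Paths that stay in the vertex set [F]. *)
Definition connected_in (V : Type) (adj : V -> V -> Prop) (F : set V) : Prop :=
  forall x y, F x -> F y ->
    clos_refl_trans V (fun u v => [/\ F u, F v & adj u v]) x y.

Record cgraph := CGraph {
  vtx :> Type;
  adj : vtx -> vtx -> Prop;
  adj_sym : forall x y, adj x y -> adj y x;
  adj_irr : forall x, ~ adj x x;
  cgraph_nonempty : inhabited vtx;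
  cgraph_connected : connected_in adj setT
}.

Section Automorphisms.
Variable T : cgraph.

Record gaut := GAut {
  aut_fun :> T -> T;
  aut_inv : T -> T;
  aut_funK : cancel aut_fun aut_inv;
  aut_invK : cancel aut_inv aut_fun;
  aut_adj : forall x y, adj (aut_fun x) (aut_fun y) <-> adj x y
}.

HB.instance Definition _ := gen_eqMixin gaut.
HB.instance Definition _ := gen_choiceMixin gaut.

Lemma aut_ext (f g : gaut) : f =1 g -> f = g.
Proof.
case: f g => [f f' fK f'K fa] [g g' gK g'K ga] /= /funext fg.
subst g; have fg' : f' = g'.
  by apply/funext => x; rewrite -[x in LHS]g'K fK.
by subst g'; congr GAut; exact: Prop_irrelevance.
Qed.

Definition aut_one : gaut.
Proof. by exists id id. Defined.

Definition aut_mul (f g : gaut) : gaut.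
Proof.
exists (f \o g) (aut_inv g \o aut_inv f).
- by move=> x /=; rewrite aut_funK aut_funK.
- by move=> x /=; rewrite aut_invK aut_invK.
- by move=> x y /=; rewrite !aut_adj.
Defined.

Definition aut_opp (f : gaut) : gaut.
Proof.
exists (aut_inv f) f; [exact: aut_invK | exact: aut_funK |].
by move=> x y; rewrite -{2}(aut_invK f x) -{2}(aut_invK f y) aut_adj.
Defined.

Lemma aut_mulA : associative aut_mul. Proof. by move=> f g h; exact: aut_ext. Qed.
Lemma aut_mul1 : left_id aut_one aut_mul. Proof. by move=> f; exact: aut_ext. Qed.
Lemma aut_1mul : right_id aut_one aut_mul. Proof. by move=> f; exact: aut_ext. Qed.
Lemma aut_mulV : left_inverse aut_one aut_opp aut_mul.
Proof. by move=> f; apply: aut_ext => x /=; rewrite aut_funK. Qed.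
Lemma aut_Vmul : right_inverse aut_one aut_opp aut_mul.
Proof. by move=> f; apply: aut_ext => x /=; rewrite aut_invK. Qed.

HB.instance Definition _ :=
  isGroup.Build gaut aut_mulA aut_mul1 aut_1mul aut_mulV aut_Vmul.

(* Vertex sets of finite connected subgraphs; when [T] is a tree these are     *)
(* exactly the vertex sets of its finite subtrees.                             *)
Definition finite_subtree : set (set T) :=
  [set F | [/\ F !=set0, finite_set F & connected_in (@adj T) F]].

Definition fixator (F : set T) : set gaut := [set g | forall x, F x -> g x = x].

Definition aut_nbhs (g : gaut) : set_system gaut :=
  filter_from finite_subtree (fun F => [set g * h | h in fixator F]).

HB.instance Definition _ := hasNbhs.Build gaut aut_nbhs.

End Automorphisms.

Section AutTopology.
Variable T : cgraph.

Lemma connected_in_mono (F F' : set T) : F `<=` F' -> forall x y,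
  clos_refl_trans T (fun u v => [/\ F u, F v & adj u v]) x y ->
  clos_refl_trans T (fun u v => [/\ F' u, F' v & adj u v]) x y.
Proof.
move=> FF' x y; elim=> [u v [Fu Fv uv]|u|u v w _ uv _ vw].
- by apply: rt_step; split=> //; exact: FF'.
- exact: rt_refl.
- exact: rt_trans uv vw.
Qed.

Lemma connected_in_sym (F : set T) x y :
  clos_refl_trans T (fun u v => [/\ F u, F v & adj u v]) x y ->
  clos_refl_trans T (fun u v => [/\ F u, F v & adj u v]) y x.
Proof.
elim=> [u v [Fu Fv uv]|u|u v w _ uv _ vw].
- by apply: rt_step; split=> //; exact: adj_sym.
- exact: rt_refl.
- exact: rt_trans vw uv.
Qed.

Lemma connected_inU (F F' : set T) z : F z -> F' z ->
  connected_in (@adj T) F -> connected_in (@adj T) F' ->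
  connected_in (@adj T) (F `|` F').
Proof.
move=> Fz F'z cF cF'.
have zto y : (F `|` F') y ->
    clos_refl_trans T (fun u v => [/\ (F `|` F') u, (F `|` F') v & adj u v]) z y.
  case=> Fy; first exact: connected_in_mono (@subsetUl _ _ _) _ _ (cF _ _ Fz Fy).
  exact: connected_in_mono (@subsetUr _ _ _) _ _ (cF' _ _ F'z Fy).
by move=> x y Fx Fy; apply: (rt_trans _ _ _ z); [apply: connected_in_sym|]; exact: zto.
Qed.

Lemma path_finite_subtree (x y : T) :
  exists F, [/\ finite_subtree F, F x & F y].
Proof.
have := cgraph_connected (x := x) (y := y) I I.
elim=> [u v [_ _ uv]|u|u v w _ [F [[_ fF cF] Fu Fv]] _ [F' [[_ fF' cF'] Fv' Fw]]].
- exists [set u; v]; split; [split|by left|by right].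
  + by exists u; left.
  + by rewrite finite_setU; split; exact: finite_set1.
  + have uv' : clos_refl_trans T
        (fun a b => [/\ [set u; v] a, [set u; v] b & adj a b]) u v.
      by apply: rt_step; split=> //; [left|right].
    move=> a b [->|->] [->|->] //; try exact: rt_refl.
    exact: connected_in_sym.
- exists [set u]; split=> //; split; [by exists u|exact: finite_set1|].
  by move=> a b -> ->; exact: rt_refl.
- exists (F `|` F'); split; [split|by left|by right].
  + by exists u; left.
  + by rewrite finite_setU.
  + exact: connected_inU Fv Fv' cF cF'.
Qed.

Lemma finite_subtreeU (F F' : set T) : finite_subtree F -> finite_subtree F' ->
  exists2 E, finite_subtree E & F `|` F' `<=` E.
Proof.
move=> [[x Fx] fF cF] [[y F'y] fF' cF'].
have [P [[_ fP cP] Px Py]] := path_finite_subtree x y.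
exists ((F `|` P) `|` F'); last first.
  by move=> z [Fz|F'z]; [left; left|right].
split; first by exists x; left; left.
- by rewrite !finite_setU.
- by apply: (@connected_inU _ _ y) => //; [right|apply: (@connected_inU _ _ x)].
Qed.

Lemma fixatorM (F : set T) g h : fixator F g -> fixator F h -> fixator F (g * h).
Proof. by move=> Fg Fh x Fx /=; rewrite [LHS]/= Fh// Fg. Qed.

Lemma aut_nbhs_filter (g : gaut T) : ProperFilter (nbhs g).
Proof.
apply: filter_from_proper; last first.
  by move=> F _; exists (g * 1), 1.
apply: filter_from_filter.
  have [x] := cgraph_nonempty T.
  by have [F [fF _ _]] := path_finite_subtree x x; exists F.
move=> F F' fF fF'; have [E fE FE] := finite_subtreeU fF fF'.
exists E => //= _ [h hE <-].
by split; exists h => // x Fx; apply: hE; apply: FE; [left|right].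
Qed.

Lemma aut_nbhs_singleton (g : gaut T) (A : set (gaut T)) : nbhs g A -> A g.
Proof. by case=> F _; apply; exists 1 => //; rewrite mulg1. Qed.

Lemma aut_nbhs_nbhs (g : gaut T) (A : set (gaut T)) :
  nbhs g A -> nbhs g (nbhs^~ A).
Proof.
case=> F fF FA; exists F => // _ [h hF <-]; exists F => // _ [k kF <-].
by apply: FA; exists (h * k); [exact: fixatorM | rewrite mulgA].
Qed.

HB.instance Definition _ := Nbhs_isNbhsTopological.Build (gaut T)
  aut_nbhs_filter aut_nbhs_singleton aut_nbhs_nbhs.

End AutTopology.

Section BassSerreTree.
Variable X : ray_of_groups.

Definition lcoset_of i (g : pi1 X) : set (pi1 X) :=
  [set g * vmap a | a in [set: vgrp X i]].

(* The vertices are the cosets of the groups of the x_i in the fundamental     *)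
(* group, indexed by [i].                                                      *)
Record bs_vertex := BsVertex {
  level : nat;
  vcoset : set (pi1 X);
  vcosetP : exists g, vcoset = lcoset_of level g
}.

Definition bs_vert (i : nat) (g : pi1 X) : bs_vertex :=
  BsVertex (ex_intro (fun h => lcoset_of i g = lcoset_of i h) g erefl).

Lemma bs_vertex_ext (v w : bs_vertex) :
  level v = level w -> vcoset v = vcoset w -> v = w.
Proof.
case: v w => [i A pA] [j B pB] /= ij AB; subst j; subst B.
by congr BsVertex; exact: Prop_irrelevance.
Qed.

Lemma bs_vertexE (v : bs_vertex) : exists g, v = bs_vert (level v) g.
Proof. by have [g gE] := vcosetP v; exists g; exact: bs_vertex_ext. Qed.

(* The edge given by the coset of [g] modulo [egrp X i] joins the cosets of    *)
(* [g] modulo [vgrp X i] and [vgrp X i.+1]. The graph being a tree, an edge is *)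
(* determined by its ends, so that a simple graph loses no information.        *)
Definition bs_adj (v w : bs_vertex) : Prop :=
  exists i g, (v = bs_vert i g /\ w = bs_vert i.+1 g) \/
              (w = bs_vert i g /\ v = bs_vert i.+1 g).

Lemma bs_vert_mulr i g (a : vgrp X i) : bs_vert i (g * vmap a) = bs_vert i g.
Proof.
apply: bs_vertex_ext => //=; apply/seteqP; split=> _ [b _ <-].
  by exists (a * b) => //; rewrite vmapM mulgA.
by exists (a^-1 * b) => //; rewrite -mulgA -vmapM mulKVg.
Qed.

Lemma bs_adj_sym v w : bs_adj v w -> bs_adj w v.
Proof. by case=> i [g [H|H]]; exists i, g; [right|left]. Qed.

Lemma bs_adj_irr v : ~ bs_adj v v.
Proof.
by case=> i [g [[-> /(congr1 level)/= /esym/eqP]|[-> /(congr1 level)/= /esym/eqP]]];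
  rewrite (gtn_eqF (ltnSn i)).
Qed.

Lemma bs_nonempty : inhabited bs_vertex.
Proof. by split; exact: (bs_vert 0%N 1). Qed.

Lemma bs_connected : connected_in bs_adj setT.
Proof.
set R := clos_refl_trans bs_vertex (fun u v => [/\ setT u, setT v & bs_adj u v]).
have Rsym u v : R u v -> R v u.
  elim=> [{}u {}v [_ _ uv]|{}u|{}u {}v w _ uv _ vw].
  - by apply: rt_step; split=> //; exact: bs_adj_sym.
  - exact: rt_refl.
  - exact: rt_trans vw uv.
have to0 i g : R (bs_vert i g) (bs_vert 0%N g).
  elim: i => [|i IH]; first exact: rt_refl.
  by apply: rt_trans IH; apply: rt_step; split=> //; exists i, g; right.
have base (u : seq (letter X)) : forall g,
    R (bs_vert 0%N (g * pi1_word u)) (bs_vert 0%N g).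
  elim: u => [|[i a] u IH] g; first by rewrite [_ * _]mulg1; exact: rt_refl.
  have -> : g * pi1_word (existT _ i a :: u) = (g * vmap a) * pi1_word u.
    by rewrite -mulgA; congr (_ * _); rewrite [RHS]pi1_mulE.
  apply: rt_trans (IH _) _; apply: rt_trans (Rsym _ _ (to0 i _)) _.
  by rewrite bs_vert_mulr; exact: to0.
have to1 v : R v (bs_vert 0%N 1).
  have [g ->] := bs_vertexE v; apply: rt_trans (to0 _ _) _.
  by rewrite -[g]pi1_reprK -[X in bs_vert _ X]mul1g; exact: base.
by move=> x y _ _; apply: rt_trans (to1 x) _; exact: Rsym.
Qed.

Definition bs_tree : cgraph :=
  CGraph bs_adj_sym bs_adj_irr bs_nonempty bs_connected.

Definition translate (g : pi1 X) (v : bs_vertex) : bs_vertex.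
Proof.
exists (level v) [set g * h | h in vcoset v].
have [k ->] := vcosetP v; exists (g * k).
apply/seteqP; split=> [_ [_ [a _ <-] <-]|_ [a _ <-]].
  by exists a; rewrite // mulgA.
by exists (k * vmap a); [exists a | rewrite mulgA].
Defined.

Lemma translate_vert g i h : translate g (bs_vert i h) = bs_vert i (g * h).
Proof.
apply: bs_vertex_ext => //=; apply/seteqP; split=> [_ [_ [a _ <-] <-]|_ [a _ <-]].
  by exists a; rewrite // mulgA.
by exists (h * vmap a); [exists a | rewrite mulgA].
Qed.

Lemma translateK g : cancel (translate g) (translate g^-1).
Proof. by move=> v; have [h ->] := bs_vertexE v; rewrite !translate_vert mulKg. Qed.

Lemma translateVK g : cancel (translate g^-1) (translate g).
Proof. by move=> v; have [h ->] := bs_vertexE v; rewrite !translate_vert mulVKg. Qed.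

Lemma translate_adj g v w : bs_adj v w -> bs_adj (translate g v) (translate g w).
Proof.
by case=> i [h [[-> ->]|[-> ->]]]; exists i, (g * h); rewrite !translate_vert; [left|right].
Qed.

Lemma translate_adjE g v w :
  bs_adj (translate g v) (translate g w) <-> bs_adj v w.
Proof.
split; last exact: translate_adj.
by move=> /(translate_adj g^-1); rewrite !translateK.
Qed.

Definition pi1_act (g : pi1 X) : gaut bs_tree :=
  @GAut bs_tree _ _ (translateK g) (translateVK g) (translate_adjE g).

Lemma pi1_actM g h : pi1_act (g * h) = pi1_act g * pi1_act h.
Proof.
by apply: aut_ext => v /=; have [k ->] := bs_vertexE v; rewrite !translate_vert mulgA.
Qed.

(* [level v] is the unique [i] such that [v] lies in the orbit of x_i.         *)
Lemma level_orbit (v : bs_vertex) i :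
  level v = i <-> exists g, v = pi1_act g (bs_vert i 1).
Proof.
split=> [<-|[g ->]] //; have [g gE] := bs_vertexE v.
by exists g; rewrite /= translate_vert mulg1.
Qed.

(* Image of the fundamental group in the automorphism group of its tree.       *)
Definition lattice : set (gaut bs_tree) := range pi1_act.

Definition level_preserving : set (gaut bs_tree) :=
  [set g | forall v : bs_vertex, level (g v) = level v].

End BassSerreTree.

Arguments lattice : clear implicits.
Arguments level_preserving : clear implicits.

(* [K] is a subgroup of [H] with finitely many left cosets.                    *)
Definition finite_index (G : groupType) (K H : set G) : Prop :=
  K `<=` H /\ finite_set [set [set a * k | k in K] | a in H].

Definition commensurator (G : groupType) (H : set G) : set G :=
  [set g | let Hg := [set g * h * g^-1 | h in H] in
     finite_index (H `&` Hg) H /\ finite_index (H `&` Hg) Hg].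

Definition dense_in (T : topologicalType) (A B : set T) : Prop :=
  A `<=` B /\ B `<=` closure A.

(* Main.v *)
Require Import Defs.
From mathcomp Require Import all_boot all_fingroup finmap generic_quotient.
From mathcomp Require Import all_classical topology_structure.

(** Write Gamma for the fundamental group and Gamma_0, Gamma_1, ... for the
    vertex groups. A level-preserving automorphism of the tree permutes the
    flags (x Gamma_0, x Gamma_1, x Gamma_2, ...), hence comes from a map lg of
    Gamma that sends each coset x Gamma_i into lg x Gamma_i. Such a map is
    described by local data: bijections s x of the Gamma_i with
    lg (x a) = lg x * s x a, subject to the cocycle identity
    s x (a b) = s x a * s (x a) b. As Gamma is the amalgam over H_0 of Gamma_0
    and the union of the Gamma_i with i > 0, the data on Gamma_0 and those on
    the other groups can be chosen independently, as soon as they agree on H_0.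

    Periodic data give elements of the commensurator. Let Gamma act on the
    right on a finite set Q and suppose that s x only depends on the point
    q0 x of Q. The map dev developed from such data satisfies
    dev (y x) = dev y * dev x for y in the stabilizer of q0, so the induced
    automorphism h conjugates this subgroup of finite index into Gamma. The
    inverse of h is developed from the inverse bijections, which form data of
    the same kind for another action on Q, whence h commensurates Gamma
    ([cocycle_commensurates]).

    On a finite subtree, arbitrary data agree with periodic ones
    ([tree_cocycle_of_lift]). Let n.+1 bound the levels of the subtree. The
    points of Gamma that matter form a finite set P, on parts of which Gamma_0
    and Gamma_(n+1) act by right multiplication. Embed P in a finite free
    H_0-set Q of cardinality divisible by the orders of both groups. Each of
    the two partial actions extends to Q, because the points where it is not
    defined form a free H_0-set of divisible cardinality
    ([free_action_complete]); the data are the identity at these new points.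

    The direct splitting takes care of the levels above n.+1. There Gamma_i
    acts on Q through a retraction tr onto Gamma_(n+1), whose kernel is
    U_(n+2) x ... x U_i, and s a is defined as s (tr a) times the truncation
    error (tr a)^-1 a. This is a cocycle because the data on Gamma_(n+1) can be
    normalized to preserve the classes modulo U_1 x ... x U_(n+1)
    ([adapted_lift]), and this group commutes with the truncation errors
    ([truncation_error_comm]). *)

Set Implicit Arguments.
Unset Strict Implicit.
Unset Printing Implicit Defensive.

Local Open Scope group_scope.

(** * Free actions of finite groups on finite sets *)

Definition right_action (G : groupType) (Q : Type) (act : Q -> G -> Q) : Prop :=
  (forall q, act q 1 = q) /\ (forall q a b, act q (a * b) = act (act q a) b).

Definition free_action (G : groupType) (Q : Type) (act : Q -> G -> Q) : Prop :=
  forall q a, act q a = q -> a = 1.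

(** Choosing a point [rep c] in each orbit turns a free action into the right
    translation action on (set of orbits) x H. *)
Lemma free_action_split (H : finGroupType) (C : finType) (act : C -> H -> C) :
  right_action act -> free_action act ->
  exists (R : finType) (f : C -> R * H) (f' : R * H -> C),
    [/\ cancel f f', cancel f' f &
        forall c h, f (act c h) = ((f c).1, (f c).2 * h)].
Proof.
move=> [act1 actM] actF.
pose orb c := [set act c h | h in [set: H]].
have orbJ c h : orb (act c h) = orb c.
  apply/setP => x; apply/imsetP/imsetP => -[k _ ->].
    by exists (h * k); rewrite ?inE// actM.
  by exists (h^-1 * k); rewrite ?inE// -actM mulKVg.
pose rep c := odflt c [pick x in orb c].
have repE c : exists h, rep c = act c h.
  rewrite /rep; case: pickP => [x /imsetP[h _ ->]|_] /=; first by exists h.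
  by exists 1; rewrite act1.
have repJ c h : rep (act c h) = rep c.
  rewrite /rep orbJ; case: pickP => //= /(_ c).
  by rewrite -{1}(act1 c) imset_f ?inE.
pose hc c := odflt 1 [pick h | act (rep c) h == c].
have hcK c : act (rep c) (hc c) = c.
  rewrite /hc; case: pickP => [h /eqP //|/=].
  by have [h ->] := repE c => /(_ h^-1); rewrite -actM mulgV act1 eqxx.
have actI c h k : act c h = act c k -> h = k.
  move=> e; have/actF : act c (h * k^-1) = c by rewrite actM e -actM mulgV act1.
  by move/(canRL (mulgKV k)); rewrite mul1g.
have hcJ c h : hc (act c h) = hc c * h.
  by apply: (@actI (rep c)); rewrite actM hcK -(repJ c h) hcK.
have rep_rep c : rep (rep c) == rep c by have [h e] := repE c; rewrite {1}e repJ.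
exists {c | rep c == c}, (fun c => (exist _ (rep c) (rep_rep c), hc c)),
  (fun x => act (val x.1) x.2).
split=> [c|[[c rc] h]|c h] /=; first by rewrite hcK.
- rewrite hcJ; congr (_, _).
    by apply: val_inj => /=; rewrite repJ (eqP rc).
  by rewrite [hc c](_ : _ = 1) ?mul1g//; apply: (@actI c); rewrite -{1}(eqP rc) hcK act1.
- by rewrite hcJ; congr (_, _); apply: val_inj; rewrite /= repJ.
Qed.

Lemma free_action_card (H : finGroupType) (C : finType) (act : C -> H -> C) :
  right_action act -> free_action act -> #|H| %| #|C|.
Proof.
move=> ra fa; have [R [f [f' [fK f'K _]]]] := free_action_split ra fa.
by rewrite (bij_eq_card (Bijective fK f'K)) card_prod dvdn_mull.
Qed.

(** By the splitting above, a finite free H-set is determined by its number of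
    orbits, hence by its cardinality. *)
Lemma free_action_iso (H : finGroupType) (C C' : finType)
    (act : C -> H -> C) (act' : C' -> H -> C') :
  right_action act -> free_action act -> right_action act' -> free_action act' ->
  #|C| = #|C'| ->
  exists (f : C -> C') (f' : C' -> C),
    [/\ cancel f f', cancel f' f & forall c h, f (act c h) = act' (f c) h].
Proof.
move=> ra fa ra' fa' cardC.
have [R [f [g [fK gK fJ]]]] := free_action_split ra fa.
have [R' [f' [g' [f'K g'K f'J]]]] := free_action_split ra' fa'.
have cardR : #|R| = #|R'|.
  move: cardC; rewrite (bij_eq_card (Bijective fK gK)) (bij_eq_card (Bijective f'K g'K)).
  by rewrite !card_prod => /eqP; rewrite eqn_pmul2r -?cardsT ?cardG_gt0// => /eqP.
pose b r := enum_val (cast_ord cardR (enum_rank r)).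
pose b' r := enum_val (cast_ord (esym cardR) (enum_rank r)).
have bK : cancel b b' by move=> r; rewrite /b /b' enum_valK cast_ordK enum_rankK.
have b'K : cancel b' b by move=> r; rewrite /b /b' enum_valK cast_ordKV enum_rankK.
exists (fun c => g' (b (f c).1, (f c).2)), (fun c => g (b' (f' c).1, (f' c).2)).
split=> [c|c|c h] /=.
- by rewrite g'K /= bK -surjective_pairing fK.
- by rewrite gK /= b'K -surjective_pairing f'K.
- by rewrite fJ /=; apply: (can_inj f'K); rewrite f'J !g'K.
Qed.

(** The model is a disjoint union of copies of G: it is a free H-set of the same
    cardinality, so its G-action can be transported. *)
Lemma free_action_extend (H G : finGroupType) (j : H -> G) (C : finType)
    (act : C -> H -> C) :
  {morph j : x y / x * y} -> injective j ->
  right_action act -> free_action act -> #|G| %| #|C| ->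
  exists actG : C -> G -> C,
    right_action actG /\ forall c h, actG c (j h) = act c h.
Proof.
move=> jM jI ra fa /dvdnP[t cardC].
have j1 : j 1 = 1 by apply: (mulgI (j 1)); rewrite -jM !mulg1.
pose act' (x : 'I_t * G) (h : H) := (x.1, x.2 * j h).
have ra' : right_action act'.
  split=> [[i x]|[i x] h k]; rewrite /act' /=; first by rewrite j1 mulg1.
  by rewrite jM mulgA.
have fa' : free_action act'.
  move=> [i x] h [] /(congr1 (fun y => x^-1 * y)); rewrite mulKg mulVg => e.
  by apply: jI; rewrite j1.
have [|f [f' [fK f'K fJ]]] := free_action_iso ra fa ra' fa'.
  by rewrite cardC card_prod card_ord mulnC.
exists (fun c a => f' ((f c).1, (f c).2 * a)); split; last first.
  by move=> c h; rewrite -[RHS]fK fJ.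
split=> [c|c a b]; first by rewrite mulg1 -surjective_pairing fK.
by rewrite f'K /= mulgA.
Qed.

(** The domain [D] of the partial action [pact] is a free G-set, so the order of
    G divides its cardinality and hence that of its complement, where any
    extension of the H-action will do. *)
Lemma free_action_complete (H G : finGroupType) (j : H -> G) (Q : finType)
    (act : Q -> H -> Q) (D : pred Q) (pact : Q -> G -> Q) :
  {morph j : x y / x * y} -> injective j ->
  right_action act -> free_action act -> #|G| %| #|Q| ->
  (forall q a, D q -> D (pact q a)) -> (forall q, D q -> pact q 1 = q) ->
  (forall q a b, D q -> pact q (a * b) = pact (pact q a) b) ->
  (forall q a, D q -> pact q a = q -> a = 1) ->
  (forall q h, D q -> pact q (j h) = act q h) ->
  exists actG : Q -> G -> Q,
    [/\ right_action actG, forall q h, actG q (j h) = act q h,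
        forall q a, D q -> actG q a = pact q a &
        forall q a, ~~ D q -> ~~ D (actG q a)].
Proof.
move=> jM jI ra fa dQ pD p1 pM pF pj.
have [act1 actM] := ra.
pose actD (q : {q | D q}) a : {q | D q} := exist D (pact (val q) a) (pD _ a (valP q)).
have dD : #|G| %| #|{: {q | D q}}|.
  apply: (@free_action_card _ _ actD).
    split=> [q|q a b]; apply: val_inj; rewrite /= ?p1 ?pM//; exact: valP.
  by move=> q a /(congr1 val) /=; apply: pF; exact: valP.
have nD q h : ~~ D q -> ~~ D (act q h).
  apply: contra => Dq; rewrite -[q]act1 -(mulgV h) actM -pj//; exact: (pD).
pose nactD (q : {q | ~~ D q}) h : {q | ~~ D q} :=
  exist (fun q => ~~ D q) (act (val q) h) (nD _ h (valP q)).
have dN : #|G| %| #|{: {q | ~~ D q}}|.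
  move: dQ; rewrite -(cardC D) dvdn_addr.
    by rewrite card_sig.
  by move: dD; rewrite card_sig.
have [||actN [[aN1 aNM] aNj]] := @free_action_extend H G j _ nactD jM jI _ _ dN.
- by split=> [q|q a b]; apply: val_inj; rewrite /= ?act1 ?actM.
- by move=> q a /(congr1 val) /=; exact: fa.
pose actG q a := if insub q is Some x then val (actN x a) else pact q a.
have aD q a : D q -> actG q a = pact q a.
  by move=> Dq; rewrite /actG; case: insubP => // x; rewrite Dq.
have aN (x : {q | ~~ D q}) a : actG (val x) a = val (actN x a) by rewrite /actG valK.
exists actG; split=> //.
- split=> [q|q a b]; case Dq: (D q).
  + by rewrite aD ?p1.
  + by have := aN (exist (fun q => ~~ D q) q (negbT Dq)) 1; rewrite aN1.
  + by rewrite !aD ?pM//; exact: (pD).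
  + by have /= e := aN (exist (fun q => ~~ D q) q (negbT Dq)); rewrite !e aNM aN.
- move=> q h; case Dq: (D q); first by rewrite aD ?pj.
  by have /= -> := aN (exist (fun q => ~~ D q) q (negbT Dq)) (j h); rewrite aNj.
- move=> q a Dq; have /= -> := aN (exist (fun q => ~~ D q) q Dq) a; by case: (actN _ a).
Qed.

(** * Retractions of a directly split tower *)

Lemma sdprod_retraction (gT rT : finGroupType) (f : {morphism [set: rT] >-> gT})
    (K : {group gT}) :
  'injm f -> K ><| f @* [set: rT] = [set: gT] ->
  exists r : gT -> rT,
    [/\ {morph r : x y / x * y}, cancel f r & forall x, x * (f (r x))^-1 \in K].
Proof.
move=> injf sd; have [nsK _ KfT _ tiKf] := sdprod_context sd.
set F := (f @* [set: rT])%G in sd KfT tiKf *.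
have inF x : remgr K F x \in F by apply: mem_remgr; rewrite KfT inE.
exists (fun x => invm injf (remgr K F x)); split=> [x y|a|x].
- rewrite (remgrM (sdprod_compl sd) nsK) ?inE//; apply: (morphM (invm_morphism injf)); exact: inF.
- rewrite remgr_id ?invmE ?inE//; first by rewrite mem_morphim ?inE.
- by rewrite invmK // -[_ * _^-1]/(divgr K F x) mem_divgr // KfT inE.
Qed.

Lemma injm_bigdprod_seq (gT rT : finGroupType) (f : {morphism [set: gT] >-> rT}) :
  'injm f -> forall (s : seq {set gT}) (K : {group gT}),
  \big[dprod/1]_(A <- s) A = K ->
  \big[dprod/1]_(A <- [seq f @* (A : {set gT}) | A <- s]) A = f @* K.
Proof.
move=> injf; elim=> [|A s IH] K.
  by rewrite !big_nil => <-; rewrite morphim1.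
rewrite map_cons !big_cons => sd; have [[A' L defA defL] _ _ _] := dprodP sd.
rewrite (IH _ defL) defA; apply: injm_dprod => //; first exact: finset.subsetT.
by rewrite -defA -defL.
Qed.

(** What the proof uses of a direct splitting. [retr i] kills U_(i+2), [kap i] is
    the projection of Gamma_(i+1) onto its factor H_0, with kernel
    U_1 x ... x U_(i+1), and [split_comm] says that this kernel commutes with
    U_(i+2). *)
Record splitting (N : nagao_data) := Splitting {
  retr : forall i, Gam N i.+2 -> Gam N i.+1;
  kap : forall i, Gam N i.+1 -> H0 N;
  retrM : forall i, {morph @retr i : x y / x * y};
  upK : forall i, cancel (Gam_up N i) (@retr i);
  kapM : forall i, {morph @kap i : x y / x * y};
  kap0 : forall h, @kap 0 (H0_in1 N h) = h;
  kapS : forall i a, @kap i.+1 a = @kap i (@retr i a);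
  split_comm : forall i a u, @kap i a = 1 -> @retr i u = 1 ->
    commute (Gam_up N i a) u
}.

Lemma directly_split_splitting (N : nagao_data) :
  directly_split N -> inhabited (splitting N).
Proof.
move=> [U [nUH sd]].
have grpV i : exists V : {group Gam N i.+1}, exists H : {group Gam N i.+1},
    [/\ \big[dprod/1]_(A <- factor_images U i) A = V, H0_image N i = H &
        V ><| H = [set: Gam N i.+1]].
  have [[V H defV defH] _ _ _] := sdprodP (sd i); exists V, H.
  by split=> //; rewrite -defV -defH; exact: sd.
pose V i := sval (cid (grpV i)).
have VP i : exists H : {group Gam N i.+1},
    [/\ \big[dprod/1]_(A <- factor_images U i) A = V i, H0_image N i = H &
        V i ><| H = [set: Gam N i.+1]] by exact: svalP (cid (grpV i)).
have VS i : (Gam_up N i @* V i) \x U i.+1 = V i.+1.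
  have [H [defV _ _]] := VP i; have [H' [defV' _ _]] := VP i.+1.
  rewrite -(injm_bigdprod_seq (Gam_up_inj N i) defV) -defV' /=.
  by rewrite -cats1 big_cat big_seq1.
(* U_(i+2) is normalized by H_0 by hypothesis and centralized by U_1 x ... x U_(i+1),
   hence it is normal in Gamma_(i+2); counting elements shows that it meets
   Gamma_(i+1) trivially. *)
have sdU i : U i.+1 ><| (Gam_up N i @* [set: Gam N i.+1]) = [set: Gam N i.+2].
  have [H [_ defH sdV]] := VP i; have [H' [_ defH' sdV']] := VP i.+1.
  have defH'u : H' = Gam_up N i @* H :> {set _} by rewrite -defH' -defH.
  have [_ VU cVU _] := dprodP (VS i).
  have [_ VH' _ _] := sdprodP sdV'.
  have upT : Gam_up N i @* [set: Gam N i.+1] = Gam_up N i @* V i * H'.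
    by rewrite defH'u -morphimMl ?finset.subsetT// (sdprodW sdV).
  have UT : U i.+1 * (Gam_up N i @* [set: Gam N i.+1]) = [set: Gam N i.+2].
    rewrite upT mulgA -VH' -VU; congr (_ * _).
    by apply: centC; rewrite // centsC.
  have nU : Gam_up N i @* [set: Gam N i.+1] \subset 'N(U i.+1).
    rewrite upT mul_subG //; first by rewrite cents_norm // centsC.
    by rewrite -defH'; exact: nUH.
  rewrite -UT; apply: sdprodE => //; apply: cardMg_TI; rewrite UT.
  rewrite -(sdprod_card sdV') -(dprod_card (VS i)).
  have -> : #|Gam_up N i @* [set: Gam N i.+1]| = (#|Gam_up N i @* V i| * #|H'|)%N.
    rewrite defH'u !card_injm ?finset.subsetT ?Gam_up_inj//.
    by rewrite (sdprod_card sdV).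
  by rewrite mulnCA mulnA.
pose dn i := sval (cid (sdprod_retraction (Gam_up_inj N i) (sdU i))).
have dnP i : [/\ {morph dn i : x y / x * y}, cancel (Gam_up N i) (dn i) &
    forall x, x * (Gam_up N i (dn i x))^-1 \in U i.+1].
  exact: svalP (cid (sdprod_retraction (Gam_up_inj N i) (sdU i))).
have sd0 : V 0 ><| (H0_in1 N @* [set: H0 N]) = [set: Gam N 1].
  by have [H [_ /= defH sdV]] := VP 0; rewrite defH.
have [k0 [k0M k0K k0V]] := sdprod_retraction (H0_in1_inj N) sd0.
pose kp := fix kp i : Gam N i.+1 -> H0 N :=
  match i with 0 => k0 | i'.+1 => fun a => kp i' (dn i' a) end.
have kpV i a : kp i a = 1 -> a \in V i.
  elim: i a => [|i IH] a /=; first by move=> k1; have := k0V a; rewrite k1 morph1 invg1 mulg1.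
  move=> /IH dV; have [_ _ /(_ a) dU] := dnP i.
  rewrite -(mulgKV (Gam_up N i (dn i a)) a) -(dprodW (VS i)).
  rewrite (centC (A := _ @* _)); last by have [_ _ cVU _] := dprodP (VS i); rewrite centsC.
  by rewrite mem_mulg// mem_morphim ?inE.
suff : splitting N by [].
apply: (@Splitting N dn kp).
- by move=> i; have [] := dnP i.
- by move=> i; have [] := dnP i.
- by elim=> [|i IH] //= a b; have [dM _ _] := dnP i; rewrite dM IH.
- exact: k0K.
- by [].
- move=> i a u /kpV Va du; have [_ _ cUV _] := dprodP (VS i).
  have Uu : u \in U i.+1.
    by have [_ _ /(_ u)] := dnP i; rewrite du morph1 invg1 mulg1.
  have fa : Gam_up N i a \in Gam_up N i @* V i by rewrite mem_morphim ?inE.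
  exact: commute_sym (centP (fintype.subsetP cUV u Uu) _ fa).
Qed.

Section Truncation.

(** The projection of the i-th group of a tower onto the n-th one: [up] is
    iterated below n and [dn] above. The recursion on n shifts the tower, which
    spares all casts between the groups [G i]. *)
Fixpoint trunc (n : nat) : forall (G : nat -> finGroupType)
    (up : forall i, G i -> G i.+1) (dn : forall i, G i.+1 -> G i) i, G i -> G n :=
  match n return forall (G : nat -> finGroupType)
    (up : forall i, G i -> G i.+1) (dn : forall i, G i.+1 -> G i) i, G i -> G n with
  | 0 => fun G up dn => fix lower i : G i -> G 0 :=
      match i with 0 => id | i'.+1 => fun a => lower i' (dn i' a) end
  | n'.+1 => fun G up dn i =>
      let rec := @trunc n' (fun i => G i.+1) (fun i => up i.+1) (fun i => dn i.+1) in
      match i with 0 => fun a => rec 0 (up 0 a) | i'.+1 => rec i' end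
  end.

Implicit Type G : nat -> finGroupType.

Lemma trunc_up n G (up : forall i, G i -> G i.+1) (dn : forall i, G i.+1 -> G i) i a :
  (forall i, cancel (up i) (dn i)) ->
  trunc n up dn (up i a) = trunc n up dn a.
Proof.
elim: n G up dn i a => [|n IH] G up dn i a udK /=; first by rewrite udK.
case: i a => //= i a; exact: (IH (fun i => G i.+1) (fun i => up i.+1)).
Qed.

Lemma trunc_down n G (up : forall i, G i -> G i.+1) (dn : forall i, G i.+1 -> G i) i
    (a : G i.+1) :
  n <= i -> trunc n up dn a = trunc n up dn (dn i a).
Proof.
elim: n G up dn i a => [|n IH] G up dn [|i] a //=.
exact: (IH (fun i => G i.+1) (fun i => up i.+1) (fun i => dn i.+1)).
Qed.

Lemma trunc_id n G (up : forall i, G i -> G i.+1) (dn : forall i, G i.+1 -> G i)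
    (a : G n) : trunc n up dn a = a.
Proof.
elim: n G up dn a => [|n IH] G up dn a //=.
exact: (IH (fun i => G i.+1) (fun i => up i.+1) (fun i => dn i.+1)).
Qed.

Lemma truncM n G (up : forall i, G i -> G i.+1) (dn : forall i, G i.+1 -> G i) i :
  (forall i, {morph up i : x y / x * y}) -> (forall i, {morph dn i : x y / x * y}) ->
  {morph (@trunc n G up dn i) : x y / x * y}.
Proof.
elim: n G up dn i => [|n IH] G up dn i uM dM.
  by elim: i => [|i IHi] a b //=; rewrite dM; exact: IHi.
have M := IH (fun i => G i.+1) (fun i => up i.+1) (fun i => dn i.+1) _
             (fun i => uM i.+1) (fun i => dM i.+1).
by case: i => [|i] a b /=; rewrite ?uM M.
Qed.

Lemma trunc_le n G (up : forall i, G i -> G i.+1) (dn : forall i, G i.+1 -> G i)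
    T (v : forall i, G i -> T) i (a : G i) :
  (forall i a, v i.+1 (up i a) = v i a) -> i <= n -> v n (trunc n up dn a) = v i a.
Proof.
elim: n G up dn v i a => [|n IH] G up dn v [|i] a vup //= lein.
  by rewrite (IH (fun i => G i.+1) (fun i => up i.+1) (fun i => dn i.+1) (fun i => v i.+1)) ?vup// => *; exact: vup.
by rewrite (IH (fun i => G i.+1) (fun i => up i.+1) (fun i => dn i.+1) (fun i => v i.+1))// => *; exact: vup.
Qed.

Lemma trunc_compat n G (up : forall i, G i -> G i.+1) (dn : forall i, G i.+1 -> G i)
    T (k : forall i, G i -> T) i (a : G i) :
  (forall i, cancel (up i) (dn i)) -> (forall i a, k i.+1 a = k i (dn i a)) ->
  k n (trunc n up dn a) = k i a.
Proof.
elim: n G up dn k i a => [|n IH] G up dn k i a udK kd /=.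
  by elim: i a => [|i IHi] a //=; rewrite kd -[RHS]IHi.
have IH' := IH (fun i => G i.+1) (fun i => up i.+1) (fun i => dn i.+1) (fun i => k i.+1) _ _
             (fun i => udK i.+1) (fun i => kd i.+1).
by case: i a => [|i] a /=; rewrite IH' // kd udK.
Qed.

End Truncation.

(** * Cocycles and the maps they develop *)

(** The cocycle of an orbit equivalence: q * (cval q a) = q . a defines a second
    action of K with the same orbits. The inverse bijections [cinv] are stored so
    that the roles of the two actions can be exchanged, as [cflip] does. *)
Record cocycle (K : finGroupType) (Q : Type) := Cocycle {
  cact : Q -> K -> Q;
  cval : Q -> K -> K;
  cinv : Q -> K -> K;
  cactP : right_action cact;
  cvalK : forall q, cancel (cval q) (cinv q);
  cinvK : forall q, cancel (cinv q) (cval q);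
  cvalM : forall q a b, cval q (a * b) = cval q a * cval (cact q a) b
}.

Section CocycleTheory.
Variables (K : finGroupType) (Q : Type) (c : cocycle K Q).

Lemma cval1 q : cval c q 1 = 1.
Proof.
have := cvalM c q 1 1; rewrite mulg1 (proj1 (cactP c)) => /(congr1 (fun x => (cval c q 1)^-1 * x)).
by rewrite mulKg mulVg.
Qed.

Lemma cvalV q a : cval c q a^-1 * cval c (cact c q a^-1) a = 1.
Proof. by rewrite -cvalM mulVg cval1. Qed.

Definition cflip_act q a := cact c q (cinv c q a).

Lemma cflipM q a b : cinv c q (a * b) = cinv c q a * cinv c (cflip_act q a) b.
Proof. by apply: (can_inj (cvalK c q)); rewrite cinvK cvalM !cinvK. Qed.

Lemma cflip_actP : right_action cflip_act.
Proof.
rewrite /cflip_act; split=> [q|q a b].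
  by have := cvalK c q 1; rewrite cval1 => ->; rewrite (proj1 (cactP c)).
by rewrite cflipM (proj2 (cactP c)).
Qed.

Definition cflip : cocycle K Q :=
  Cocycle cflip_actP (cinvK c) (cvalK c) cflipM.

End CocycleTheory.

Section Development.
Variables (N : nagao_data) (S : splitting N).

Local Notation X := (nagao_ray N).
Local Notation Gamma := (pi1 X).

Definition vmap0 (b : Gam N 0) : Gamma := @vmap X 0%N b.
Definition vmapS i (a : Gam N i.+1) : Gamma := @vmap X i.+1 a.

Lemma vmap0M : {morph vmap0 : x y / x * y}. Proof. exact: (@vmapM X 0%N). Qed.
Lemma vmapSM i : {morph @vmapS i : x y / x * y}. Proof. exact: (@vmapM X i.+1). Qed.
Lemma vmap01 : vmap0 1 = 1. Proof. exact: (@vmap1 X 0%N). Qed.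
Lemma vmapS1 i : @vmapS i 1 = 1. Proof. exact: (@vmap1 X i.+1). Qed.

Lemma vmapSV i (a : Gam N i.+1) : vmapS a^-1 = (vmapS a)^-1.
Proof. by apply: (mulgI (vmapS a)); rewrite -vmapSM !mulgV vmapS1. Qed.

Lemma vmap_H0 h : vmap0 (H0_in0 N h) = vmapS (H0_in1 N h).
Proof. exact: (@vmap_edge X 0%N h). Qed.

Lemma vmap_up i (a : Gam N i.+1) : vmapS (Gam_up N i a) = vmapS a.
Proof. exact: esym (@vmap_edge X i.+1 a). Qed.

Lemma pi1_elim (P : Gamma -> Prop) :
  P 1 -> (forall b x, P x -> P (vmap0 b * x)) ->
  (forall i (a : Gam N i.+1) x, P x -> P (vmapS a * x)) -> forall x, P x.
Proof.
move=> P1 P0 PS x; rewrite -[x]pi1_reprK; elim: (repr x) => [//|[[|i] a] u IH].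
  suff -> : pi1_word (existT _ 0%N a :: u) = vmap0 a * pi1_word u by exact: P0.
  by rewrite /vmap0 /vmap [RHS]pi1_mulE.
suff -> : pi1_word (existT _ i.+1 a :: u) = vmapS a * pi1_word u by exact: PS.
by rewrite /vmapS /vmap [RHS]pi1_mulE.
Qed.

(** Universal property of the fundamental group, for right actions. *)
Lemma pi1_action (T : Type) (a0 : T -> Gam N 0 -> T) (aS : forall i, T -> Gam N i.+1 -> T) :
  right_action a0 -> (forall i, right_action (aS i)) ->
  (forall s h, a0 s (H0_in0 N h) = aS 0%N s (H0_in1 N h)) ->
  (forall i s a, aS i s a = aS i.+1 s (Gam_up N i a)) ->
  exists act : T -> Gamma -> T,
    [/\ right_action act, forall s b, act s (vmap0 b) = a0 s b &
        forall i s a, act s (@vmapS i a) = aS i s a].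
Proof.
move=> [a01 a0M] aSP eH eU.
pose la (s : T) (l : letter X) : T :=
  let: existT i g := l in
  (match i return Gam N i -> T with 0 => a0 s | i.+1 => aS i s end) g.
have la_eq u w : word_eq u w -> forall s, foldl la s u = foldl la s w.
  elim=> //.
  - by move=> u1 w1 z _ IH1 _ IH2 s; rewrite IH1 IH2.
  - by move=> u1 u2 w1 w2 _ IH1 _ IH2 s; rewrite !foldl_cat IH1 IH2.
  - by case=> [|i] s /=; rewrite ?a01 ?(proj1 (aSP i)).
  - by case=> [|i] g h s /=; rewrite ?a0M ?(proj2 (aSP i)).
  - by case=> [|i] a s /=; [exact: eH | exact: eU].
have laE s u : foldl la s (repr (pi1_word u)) = foldl la s u.
  exact/la_eq/word_eq_repr.
exists (fun s x => foldl la s (repr x)); split.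
- split=> [s|s x y]; first exact: laE.
  by rewrite [LHS]laE foldl_cat.
- by move=> s b; rewrite [LHS]laE.
- by move=> i s a; rewrite [LHS]laE.
Qed.

Lemma kap1 i : kap S (1 : Gam N i.+1) = 1.
Proof. by apply: (mulgI (kap S (1 : Gam N i.+1))); rewrite -kapM !mulg1. Qed.

Section Level.
Variable n : nat.

Definition tr i : Gam N i.+1 -> Gam N n.+1 :=
  @trunc n (fun i => Gam N i.+1) (fun i => Gam_up N i) (@retr N S) i.

Definition H0M (h : H0 N) : Gam N n.+1 := tr (H0_in1 N h).

Let upM i : {morph Gam_up N i : x y / x * y}.
Proof. by move=> x y; rewrite morphM ?inE. Qed.

Lemma trM i : {morph @tr i : x y / x * y}.
Proof. exact: truncM upM (retrM S). Qed.

Lemma tr1 i : @tr i 1 = 1.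
Proof. by apply: (mulgI (@tr i 1)); rewrite -trM !mulg1. Qed.

Lemma tr_up i a : tr (Gam_up N i a) = tr a.
Proof. exact: (@trunc_up n (fun i => Gam N i.+1) _ _ i a (upK S)). Qed.

Lemma tr_retr i (a : Gam N i.+2) : n <= i -> tr a = tr (retr S a).
Proof. exact: (@trunc_down n (fun i => Gam N i.+1)). Qed.

Lemma tr_id (a : Gam N n.+1) : tr a = a.
Proof. exact: (@trunc_id n (fun i => Gam N i.+1)). Qed.

Lemma vmap_tr i (a : Gam N i.+1) : i <= n -> vmapS (tr a) = vmapS a.
Proof. exact: (@trunc_le n (fun i => Gam N i.+1) _ _ _ (@vmapS) i a (@vmap_up)). Qed.

Lemma kap_tr i (a : Gam N i.+1) : kap S (tr a) = kap S a.
Proof. exact: (@trunc_compat n (fun i => Gam N i.+1) _ _ _ (@kap N S) i a (upK S) (@kapS N S)). Qed.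

Lemma kapH0M h : kap S (H0M h) = h.
Proof. by rewrite /H0M kap_tr kap0. Qed.

Lemma H0M_M : {morph H0M : x y / x * y}.
Proof. by move=> x y; rewrite /H0M -trM morphM ?inE. Qed.

Lemma H0M_inj : injective H0M.
Proof. exact: can_inj kapH0M. Qed.

Lemma vmapH0M h : vmapS (H0M h) = vmap0 (H0_in0 N h).
Proof. by rewrite vmap_tr // vmap_H0. Qed.

End Level.

Lemma vmap_tr_ge n i (m : Gam N n.+1) : n <= i -> vmapS (tr i m) = vmapS m.
Proof. exact: vmap_tr. Qed.

(** This is where the factors U_j have to commute. By induction the truncation
    error is a product of elements of U_(n+2), ..., U_(i+1), while m lies in
    U_1 x ... x U_(n+1). *)
Lemma truncation_error_comm n i (a : Gam N i.+1) (m : Gam N n.+1) :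
  kap S m = 1 -> commute ((vmapS (tr n a))^-1 * vmapS a) (vmapS m).
Proof.
move=> km; case: (leqP i n) => [lein|/ltnW leni].
  by rewrite vmap_tr // mulVg; exact: commute_sym (commute1 _).
rewrite -(subnKC leni) in a *; elim: (i - n)%N a => [|d IH].
  by rewrite addn0 => a; rewrite vmap_tr // mulVg; exact: commute_sym (commute1 _).
rewrite addnS => a; have led : n <= n + d by rewrite leq_addr.
set b := retr S a; pose k := (Gam_up N _ b)^-1 * a.
have -> : vmapS a = vmapS b * vmapS k.
  by rewrite -(vmap_up b) -vmapSM mulKVg.
rewrite (tr_retr _ led) mulgA; apply: commute_sym; apply: commuteM.
  exact: commute_sym (IH b).
rewrite -(vmap_tr_ge m led) -vmap_up /commute -!vmapSM; congr vmapS.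
apply: (split_comm (s := S)); first by rewrite kap_tr.
have retr1 : retr S 1 = 1 :> Gam N (n + d).+1.
  by apply: (mulgI (retr S 1)); rewrite -retrM !mulg1.
by rewrite retrM -/b -{2}(upK S b) -retrM mulVg retr1.
Qed.

(** Periodic local data on Q for the groups of the levels 0 and n.+1. The two
    actions and the two cocycles have to match on H_0 in order to glue to the
    amalgam. [tc_kap] is the normalization that makes the data extend to higher
    levels, and [tc_level] with [tc_levelV] ensure that the cosets of the
    intermediate groups are respected by the developed map and by its inverse. *)
Record tree_cocycle n (Q : Type) := TreeCocycle {
  tc0 : cocycle (Gam N 0) Q;
  tc1 : cocycle (Gam N n.+1) Q;
  tc_act : forall q h, cact tc0 q (H0_in0 N h) = cact tc1 q (H0M n h);
  tc_val0 : forall q h, cval tc0 q (H0_in0 N h) = H0_in0 N h;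
  tc_val1 : forall q h, cval tc1 q (H0M n h) = H0M n h;
  tc_kap : forall q a, kap S (cval tc1 q a) = kap S a;
  tc_level : forall i q (a : Gam N i.+1), i <= n ->
    exists a' : Gam N i.+1, cval tc1 q (tr n a) = tr n a';
  tc_levelV : forall i q (a : Gam N i.+1), i <= n ->
    exists a' : Gam N i.+1, cinv tc1 q (tr n a) = tr n a'
}.

Section Flip.
Variables (n : nat) (Q : Type) (c : tree_cocycle n Q).

Let inv0 q h : cinv (tc0 c) q (H0_in0 N h) = H0_in0 N h.
Proof. by rewrite -{1}(tc_val0 c q h) cvalK. Qed.

Let inv1 q h : cinv (tc1 c) q (H0M n h) = H0M n h.
Proof. by rewrite -{1}(tc_val1 c q h) cvalK. Qed.

Let flip_act q h :
  cact (cflip (tc0 c)) q (H0_in0 N h) = cact (cflip (tc1 c)) q (H0M n h).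
Proof. by rewrite /= /cflip_act inv0 inv1 tc_act. Qed.

Let flip_kap q a : kap S (cinv (tc1 c) q a) = kap S a.
Proof. by rewrite -(tc_kap c q) cinvK. Qed.

Definition tflip : tree_cocycle n Q :=
  @TreeCocycle n Q (cflip (tc0 c)) (cflip (tc1 c)) flip_act inv0 inv1 flip_kap
    (@tc_levelV _ _ c) (@tc_level _ _ c).

End Flip.

Section Skew.
Variables (n : nat) (Q : Type).
Implicit Type c : tree_cocycle n Q.

(** The skew product of the local data: following a word from (q, y), the first
    coordinate moves in Q and the second one accumulates the values of the
    cocycle. Letters of level above n.+1 contribute the value at their
    truncation, times their truncation error. *)
Lemma skew_exists c : exists act : Q * Gamma -> Gamma -> Q * Gamma,
  [/\ right_action act,
      forall s b, act s (vmap0 b) = (cact (tc0 c) s.1 b, s.2 * vmap0 (cval (tc0 c) s.1 b)) &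
      forall i s (a : Gam N i.+1), act s (vmapS a) =
        (cact (tc1 c) s.1 (tr n a),
         s.2 * (vmapS (cval (tc1 c) s.1 (tr n a)) * ((vmapS (tr n a))^-1 * vmapS a)))].
Proof.
apply: pi1_action.
- split=> [[q y]|[q y] a b] /=.
    by rewrite (proj1 (cactP _)) cval1 vmap01 mulg1.
  by rewrite (proj2 (cactP _)) cvalM vmap0M mulgA.
- move=> i; split=> [[q y]|[q y] a b] /=.
    by rewrite tr1 (proj1 (cactP _)) cval1 !vmapS1 invg1 !mulg1.
  rewrite trM (proj2 (cactP _)) cvalM; congr pair; rewrite -mulgA; congr (_ * _).
  set A := tr n a; set B := tr n b; set C := cval _ _ B.
  (* The cocycle identity amounts to exchanging the truncation error of a with
   C B^-1, which [tc_kap] puts in U_1 x ... x U_(n+1). *)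
  have kC : kap S (C * B^-1) = 1.
    by rewrite kapM tc_kap -kapM mulgV kap1.
  rewrite !vmapSM -!mulgA; congr (_ * _).
  have := truncation_error_comm a kC; rewrite -/A /commute vmapSM vmapSV => e.
  rewrite invMg -!mulgA.
  have -> : vmapS C * ((vmapS B)^-1 * ((vmapS A)^-1 * (vmapS a * vmapS b)))
     = (vmapS C * (vmapS B)^-1) * ((vmapS A)^-1 * vmapS a) * vmapS b by rewrite !mulgA.
  by rewrite -e !mulgA.
- move=> [q y] h /=; rewrite -/(H0M n h) tc_act tc_val0 tc_val1 vmapH0M -vmap_H0.
  by rewrite mulKVg.
- by move=> i [q y] a /=; rewrite tr_up vmap_up.
Qed.

Definition skew c := sval (cid (skew_exists c)).
Definition ptact c q x := (skew c (q, 1) x).1.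
Definition dev c q x := (skew c (q, 1) x).2.

Let skewP c : right_action (skew c).
Proof. by rewrite /skew; case: cid => /= f []. Qed.

Let skew0 c s b :
  skew c s (vmap0 b) = (cact (tc0 c) s.1 b, s.2 * vmap0 (cval (tc0 c) s.1 b)).
Proof. by rewrite /skew; case: cid => /= f [_ ->]. Qed.

Let skewS c i s (a : Gam N i.+1) : skew c s (vmapS a) =
  (cact (tc1 c) s.1 (tr n a),
   s.2 * (vmapS (cval (tc1 c) s.1 (tr n a)) * ((vmapS (tr n a))^-1 * vmapS a))).
Proof. by rewrite /skew; case: cid => /= f [_ _ ->]. Qed.

Lemma skewE c q y x : skew c (q, y) x = (ptact c q x, y * dev c q x).
Proof.
rewrite /ptact /dev -[y in LHS]mulg1; move: q 1; move: x; apply: pi1_elim.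
- by move=> q z; rewrite !(proj1 (skewP c)).
- by move=> b x IH q z; rewrite !(proj2 (skewP c)) !skew0 /= -mulgA IH.
- by move=> i a x IH q z; rewrite !(proj2 (skewP c)) !skewS /= -mulgA IH.
Qed.

Lemma ptactP c : right_action (ptact c).
Proof.
split=> [q|q x y]; first by rewrite /ptact (proj1 (skewP c)).
by rewrite {1}/ptact (proj2 (skewP c)) skewE skewE.
Qed.

Lemma devM c q x y : dev c q (x * y) = dev c q x * dev c (ptact c q x) y.
Proof. by rewrite {1}/dev (proj2 (skewP c)) skewE skewE mul1g. Qed.

Lemma dev1 c q : dev c q 1 = 1.
Proof. by rewrite /dev (proj1 (skewP c)). Qed.

Lemma ptact0 c q b : ptact c q (vmap0 b) = cact (tc0 c) q b.
Proof. by rewrite /ptact skew0. Qed.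

Lemma dev0 c q b : dev c q (vmap0 b) = vmap0 (cval (tc0 c) q b).
Proof. by rewrite /dev skew0 /= mul1g. Qed.

Lemma ptactS c q i (a : Gam N i.+1) : ptact c q (vmapS a) = cact (tc1 c) q (tr n a).
Proof. by rewrite /ptact skewS. Qed.

Lemma devS c q i (a : Gam N i.+1) : dev c q (vmapS a) =
  vmapS (cval (tc1 c) q (tr n a)) * ((vmapS (tr n a))^-1 * vmapS a).
Proof. by rewrite /dev skewS /= mul1g. Qed.

Lemma dev_low c q i (a : Gam N i.+1) : i <= n ->
  dev c q (vmapS a) = vmapS (cval (tc1 c) q (tr n a)).
Proof. by move=> lein; rewrite devS vmap_tr // mulVg mulg1. Qed.

(** Truncation errors act trivially on Q and are copied unchanged, for whatever
    local data. The inverse data therefore undo the development at all levels. *)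
Lemma skew_truncation_error c q i (a : Gam N i.+1) :
  ptact c q ((vmapS (tr n a))^-1 * vmapS a) = q /\
  dev c q ((vmapS (tr n a))^-1 * vmapS a) = (vmapS (tr n a))^-1 * vmapS a.
Proof.
rewrite -vmapSV (proj2 (ptactP c)) devM !ptactS dev_low // devS !tr_id.
rewrite -(proj2 (cactP _)) mulVg (proj1 (cactP _)); split=> //.
by rewrite mulgA -vmapSM cvalV vmapS1 mul1g vmapSV.
Qed.

(** Stated for any [c'] that undoes [c], so as to cover both [c, tflip c] and
    [tflip c, c]: the cocycle [tflip (tflip c)] agrees with [c] only pointwise. *)
Lemma dev_inverse c c' q x :
  (forall p a, cact (tc0 c') p (cval (tc0 c) p a) = cact (tc0 c) p a) ->
  (forall p a, cval (tc0 c') p (cval (tc0 c) p a) = a) ->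
  (forall p a, cact (tc1 c') p (cval (tc1 c) p a) = cact (tc1 c) p a) ->
  (forall p a, cval (tc1 c') p (cval (tc1 c) p a) = a) ->
  ptact c' q (dev c q x) = ptact c q x /\ dev c' q (dev c q x) = x.
Proof.
move=> act0 val0 act1 val1; move: x q; apply: pi1_elim.
- by move=> q; rewrite !dev1 !(proj1 (ptactP _)).
- move=> b x IH q; rewrite !devM dev0 !(proj2 (ptactP _)) !ptact0 dev0 act0 val0.
  by have [-> ->] := IH (cact (tc0 c) q b).
- move=> i a x IH q; have [e1 e2] := skew_truncation_error c' (cact (tc1 c) q (tr n a)) a.
  have [h1 h2] : ptact c' q (dev c q (vmapS a)) = cact (tc1 c) q (tr n a) /\
      dev c' q (dev c q (vmapS a)) = vmapS a.
    rewrite devS (proj2 (ptactP c')) devM ptactS dev_low // tr_id act1 val1 e1 e2.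
    by rewrite mulVKg.
  rewrite devM !(proj2 (ptactP _)) devM h1 h2 ptactS.
  by have [-> ->] := IH (cact (tc1 c) q (tr n a)).
Qed.

Lemma dev_tflip c q x :
  ptact (tflip c) q (dev c q x) = ptact c q x /\ dev (tflip c) q (dev c q x) = x.
Proof. by apply: dev_inverse => p a /=; rewrite /cflip_act cvalK. Qed.

Lemma dev_tflipK c q x :
  ptact c q (dev (tflip c) q x) = ptact (tflip c) q x /\ dev c q (dev (tflip c) q x) = x.
Proof. by apply: dev_inverse => p a //=; rewrite cinvK. Qed.

Lemma dev_coset c q i x (a : vgrp X i) :
  exists a' : vgrp X i, dev c q (x * vmap a) = dev c q x * vmap a'.
Proof.
case: i a => [|i] a; rewrite devM.
  by exists (cval (tc0 c) (ptact c q x) a); rewrite dev0.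
case: (leqP i n) => [lein|/ltnW leni].
  have [a' ea'] := tc_level c (ptact c q x) a lein; exists a'.
  by rewrite dev_low // ea' vmap_tr.
exists (tr i (cval (tc1 c) (ptact c q x) (tr n a)) * ((tr i (tr n a))^-1 * a)).
rewrite devS -[@vmap X i.+1]/(@vmapS i) !vmapSM vmapSV.
by rewrite !(vmap_tr_ge _ leni).
Qed.

End Skew.

End Development.

Local Open Scope classical_set_scope.

(** * Automorphisms of the tree and the commensurator *)

Section FlagMap.
Variable X : ray_of_groups.
Local Notation Gamma := (pi1 X).

Lemma bs_vert_eq i (x y : Gamma) :
  bs_vert i x = bs_vert i y <-> exists a : vgrp X i, y = x * vmap a.
Proof.
split=> [/(congr1 (@vcoset X)) /= e|[a ->]]; last by rewrite bs_vert_mulr.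
have : lcoset_of i y y by exists 1 => //; rewrite vmap1 mulg1.
by rewrite -e => -[a _ <-]; exists a.
Qed.

Definition coset_map (phi : Gamma -> Gamma) :=
  forall i x (a : vgrp X i), exists a' : vgrp X i, phi (x * vmap a) = phi x * vmap a'.

Definition vertex_map (phi : Gamma -> Gamma) (v : bs_vertex X) : bs_vertex X :=
  bs_vert (level v) (phi (sval (cid (vcosetP v)))).

Lemma vertex_mapE phi i x :
  coset_map phi -> vertex_map phi (bs_vert i x) = bs_vert i (phi x).
Proof.
move=> cphi; rewrite /vertex_map; case: cid => r /= e.
have /bs_vert_eq[a ->] : bs_vert i x = bs_vert i r by exact: bs_vertex_ext.
by have [a' ->] := cphi i x a; rewrite bs_vert_mulr.
Qed.

Lemma vertex_map_adj phi v w :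
  coset_map phi -> bs_adj v w -> bs_adj (vertex_map phi v) (vertex_map phi w).
Proof.
by move=> cphi [i [g [[-> ->]|[-> ->]]]]; exists i, (phi g);
  rewrite !vertex_mapE//; [left|right].
Qed.

Lemma flag_map_aut (phi phi' : Gamma -> Gamma) :
  coset_map phi -> coset_map phi' -> cancel phi phi' -> cancel phi' phi ->
  exists h : gaut (bs_tree X), level_preserving X h /\
    forall i x, h (bs_vert i x) = bs_vert i (phi x).
Proof.
move=> c c' K K'.
have vK : cancel (vertex_map phi) (vertex_map phi').
  by move=> v; have [x ->] := bs_vertexE v; rewrite !vertex_mapE ?K.
have vK' : cancel (vertex_map phi') (vertex_map phi).
  by move=> v; have [x ->] := bs_vertexE v; rewrite !vertex_mapE ?K'.
have vA v w : bs_adj (vertex_map phi v) (vertex_map phi w) <-> bs_adj v w.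
  split; last exact: vertex_map_adj.
  by move/(vertex_map_adj c'); rewrite !vK.
exists (@GAut (bs_tree X) _ _ vK vK' vA); split=> // i x.
exact: vertex_mapE.
Qed.

Lemma aut_eq_vert (g h : gaut (bs_tree X)) :
  (forall i x, g (bs_vert i x) = h (bs_vert i x)) -> g = h.
Proof. by move=> e; apply: aut_ext => v; have [x ->] := bs_vertexE v. Qed.

Lemma pi1_act1 : pi1_act (1 : Gamma) = 1.
Proof. by apply: aut_eq_vert => i x; rewrite /= translate_vert mul1g. Qed.

Lemma pi1_actV (x : Gamma) : pi1_act x^-1 = (pi1_act x)^-1.
Proof. by apply: (mulgI (pi1_act x)); rewrite -pi1_actM !mulgV pi1_act1. Qed.

Lemma lattice_mul g h : lattice X g -> lattice X h -> lattice X (g * h).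
Proof. by move=> [x _ <-] [y _ <-]; exists (x * y); rewrite ?pi1_actM. Qed.

End FlagMap.

(** Finiteness of the index is witnessed by a map [f] to a finite set whose
    fibres lie in single cosets. *)
Lemma finite_index_classifier (G : groupType) (K H : set G) (I : Type) (Q : finType)
    (a : I -> G) (f : I -> Q) :
  K `<=` H -> (forall x y, K x -> K y -> K (x * y)) ->
  (forall x, H x -> exists i, x = a i) ->
  (forall i j, f i = f j -> K ((a i)^-1 * a j)) -> finite_index K H.
Proof.
move=> KH KM Ha fK; split=> //.
pose cos q : set G := [set x | exists i k, [/\ f i = q, K k & x = a i * k]].
apply: (@sub_finite_set _ _ (cos @` setT)); last first.
  by apply: finite_image; exact: finite_finset.
move=> _ [_ /Ha[i ->] <-]; exists (f i) => //.
apply/seteqP; split=> [_ [j [k [fji Kk ->]]]|_ [k Kk <-]]; last by exists i, k.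
exists ((a i)^-1 * a j * k); last by rewrite -mulgA mulKVg.
by apply: KM => //; exact: fK.
Qed.

(** It suffices that h conjugates into the lattice the differences within the
    fibres of one map to a finite set, and that its inverse does so for another
    such map. *)
Lemma commensurator_criterion (X : ray_of_groups) (h : gaut (bs_tree X)) (Q : finType)
    (f f' : pi1 X -> Q) :
  (forall x y, f x = f y -> exists z, h * pi1_act (x^-1 * y) = pi1_act z * h) ->
  (forall x y, f' x = f' y -> exists z, h^-1 * pi1_act (x^-1 * y) = pi1_act z * h^-1) ->
  commensurator (lattice X) h.
Proof.
move=> fh f'h; rewrite /commensurator /=.
set L := lattice X; set Lh := [set h * g * h^-1 | g in L].
have KM x y : (L `&` Lh) x -> (L `&` Lh) y -> (L `&` Lh) (x * y).
  move=> [Lx [x' Lx' ex]] [Ly [y' Ly' ey]]; split; first exact: lattice_mul.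
  exists (x' * y'); first exact: lattice_mul.
  by rewrite -ex -ey -!mulgA mulKg.
split.
- apply: (@finite_index_classifier _ _ _ (pi1 X) Q (@pi1_act X) f') => //.
    by move=> _ [x _ <-]; exists x.
  move=> x y /f'h[z ez]; rewrite -pi1_actV -pi1_actM; split; first by exists (x^-1 * y).
  exists (pi1_act z); first by exists z.
  by rewrite -mulgA -ez mulKVg.
- apply: (@finite_index_classifier _ _ _ (pi1 X) Q (fun x => h * pi1_act x * h^-1) f) => //.
    by move=> _ [_ [x _ <-] <-]; exists x.
  move=> x y /fh[z ez].
  have -> : (h * pi1_act x * h^-1)^-1 * (h * pi1_act y * h^-1) =
            h * pi1_act (x^-1 * y) * h^-1.
    by rewrite pi1_actM pi1_actV !invMg invgK -!mulgA mulKg.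
  split; last by exists (pi1_act (x^-1 * y)) => //; exists (x^-1 * y).
  by rewrite ez mulgK; exists z.
Qed.

(** The points q0 x^-1, for the two actions of Gamma on Q given by the data and by
    their inverses, classify the cosets of the two stabilizers of q0. On such a
    stabilizer the developed map is a homomorphism, and h intertwines it with
    the inclusion. The translation by y0 only adds a conjugation. *)
Lemma cocycle_commensurates (N : nagao_data) (S : splitting N) n (Q : finType)
    (c : tree_cocycle S n Q) (q0 : Q) (y0 : pi1 (nagao_ray N)) :
  exists h : gaut (bs_tree (nagao_ray N)),
    [/\ level_preserving _ h, commensurator (lattice _) h &
        forall i x, h (bs_vert i x) = bs_vert i (y0 * dev c q0 x)].
Proof.
pose phi x := y0 * dev c q0 x.
pose phi' x := dev (tflip c) q0 (y0^-1 * x).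
have K : cancel phi phi'.
  by move=> x; rewrite /phi /phi' mulKg; have [] := dev_tflip c q0 x.
have K' : cancel phi' phi.
  by move=> x; rewrite /phi /phi'; have [_ ->] := dev_tflipK c q0 (y0^-1 * x); rewrite mulKVg.
have cphi : coset_map phi.
  by move=> i x a; have [a' e] := dev_coset c q0 x a; exists a'; rewrite /phi e mulgA.
have cphi' : coset_map phi'.
  move=> i x a; have [a' e] := dev_coset (tflip c) q0 (y0^-1 * x) a.
  by exists a'; rewrite /phi' mulgA e.
have [h [lh hE]] := flag_map_aut cphi cphi' K K'.
have hVE i x : h^-1 (bs_vert i x) = bs_vert i (phi' x).
  by rewrite -{1}[x]K' -hE; exact: aut_funK.
exists h; split=> //.
apply: (@commensurator_criterion _ h Q (fun x => ptact c q0 x^-1)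
   (fun x => ptact (tflip c) q0 (y0^-1 * x^-1 * y0))) => x y e.
- have fix0 : ptact c q0 (x^-1 * y) = q0.
    by rewrite (proj2 (ptactP c)) e -(proj2 (ptactP c)) mulVg (proj1 (ptactP c)).
  exists (y0 * dev c q0 (x^-1 * y) * y0^-1); apply: aut_eq_vert => i z /=.
  by rewrite !hE /= !translate_vert hE /phi devM fix0 !mulgA mulgKV.
- set g := x^-1 * y; have fix0 : ptact (tflip c) q0 (y0^-1 * g * y0) = q0.
    have -> : y0^-1 * g * y0 = (y0^-1 * x^-1 * y0) * (y0^-1 * y * y0).
      by rewrite /g -!mulgA mulKVg.
    rewrite (proj2 (ptactP _)) e -(proj2 (ptactP _)) -!mulgA mulKVg mulKg mulVg.
    exact: (proj1 (ptactP _)).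
  exists (dev (tflip c) q0 (y0^-1 * g * y0)); apply: aut_eq_vert => i z.
  rewrite [LHS]/= [RHS]/= !translate_vert.
  have -> : aut_inv h (bs_vert i (g * z)) = bs_vert i (phi' (g * z)) by exact: hVE.
  have -> : aut_inv h (bs_vert i z) = bs_vert i (phi' z) by exact: hVE.
  rewrite translate_vert /phi'; congr (bs_vert i _).
  by rewrite -{3}fix0 -devM -!mulgA mulKVg.
Qed.

(** * Vertex groups inside the fundamental group *)

Section Injectivity.
Variables (N : nagao_data) (S : splitting N).

Let in0M : {morph H0_in0 N : x y / x * y}.
Proof. by move=> x y; rewrite morphM ?inE. Qed.

Lemma H0_in0_injective : injective (H0_in0 N).
Proof. by move=> x y; apply: (injmP (H0_in0_inj N)); rewrite inE. Qed.

(** The amalgam has no more relations between Gamma_0 and Gamma_(n+1) than those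
    imposed by H_0. The witness is an explicit action: Gamma_0 translates the
    second coordinate of Gamma_(n+1) x Gamma_0; an element a of Gamma_(n+1)
    translates it by the H_0-part of a, and translates the first coordinate by
    the remaining part of a, conjugated by the H_0-coordinate [hc] of the second.
    In the orbit of (1, 1), Gamma_0 keeps the first coordinate, so that for an
    element of both groups this remaining part is trivial. *)
Lemma vmap_meet n (m : Gam N n.+1) (b : Gam N 0) :
  vmapS m = vmap0 b -> exists h, m = H0M S n h /\ b = H0_in0 N h.
Proof.
pose act (b : Gam N 0) (h : H0 N) := b * H0_in0 N h.
have ra : right_action act.
  by split=> [x|x h k]; rewrite /act ?morph1 ?mulg1// in0M mulgA.
have fa : free_action act.
  move=> x h /(congr1 (fun y => x^-1 * y)); rewrite mulKg mulVg => e.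
  by apply: H0_in0_injective; rewrite e morph1.
have [R [f [_ [_ _ fJ]]]] := free_action_split ra fa.
have [hc hcJ hc1] : exists2 hc : Gam N 0 -> H0 N,
    forall x h, hc (x * H0_in0 N h) = hc x * h & hc 1 = 1.
  exists (fun x => ((f 1).2)^-1 * (f x).2) => [x h|]; last exact: mulVg.
  by rewrite -[x * _]/(act x h) fJ mulgA.
pose a0 (s : Gam N n.+1 * Gam N 0) b := (s.1, s.2 * b).
pose aS i (s : Gam N n.+1 * Gam N 0) (a : Gam N i.+1) :=
  (s.1 * (H0M S n (hc s.2) * (tr S n a * (H0M S n (kap S a))^-1) * (H0M S n (hc s.2))^-1),
   s.2 * H0_in0 N (kap S a)).
have H1 : H0M S n 1 = 1 by rewrite /H0M morph1 tr1.
have [||||A [_ A0 AS]] := @pi1_action N _ a0 aS.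
- by split=> [[u x]|[u x] y z]; rewrite /a0 /= ?mulg1 ?mulgA.
- move=> i; split=> [[u x]|[u x] y z]; rewrite /aS /=.
    by rewrite kap1 tr1 H1 morph1 invg1 !mulg1 mulgV mulg1.
  rewrite trM hcJ kapM in0M; congr pair; last by rewrite mulgA.
  rewrite !H0M_M !invMg -!mulgA; congr (_ * _).
  by rewrite !mulKg.
- by move=> [u x] h; rewrite /aS /a0 /= kap0 -/(H0M S n h) mulgV mulg1 mulgV mulg1.
- move=> i [u x] a; rewrite /aS /= tr_up.
  by have -> : kap S (Gam_up N i a) = kap S a by rewrite kapS upK.
move=> e; have := AS n (1, 1) m; rewrite e A0 /a0 /aS /= hc1 H1 !mul1g invg1 !mulg1 tr_id.
move=> [/esym e1 e2]; exists (kap S m); split=> //.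
by apply: (mulIg (H0M S n (kap S m))^-1); rewrite e1 mulgV.
Qed.

Lemma vmapS_inj n : injective (@vmapS N n).
Proof.
move=> a b e; have : vmapS (a^-1 * b) = vmap0 1 by rewrite vmapSM vmapSV e mulVg vmap01.
move=> /vmap_meet[h [eh /esym e1]].
have h1 : h = 1 by apply: H0_in0_injective; rewrite e1 morph1.
by apply/(mulgI a^-1); rewrite mulVg eh h1 /H0M morph1 tr1.
Qed.

Lemma vmap0_inj : injective (@vmap0 N).
Proof.
move=> a b e; have /esym : vmap0 (a^-1 * b) = vmapS (1 : Gam N 1).
  rewrite vmapS1 vmap0M -e -vmap0M mulVg; exact: vmap01.
move=> /vmap_meet[h [/esym e1 eh]].
have h1 : h = 1 by apply: (@H0M_inj _ S 0); rewrite e1 /H0M morph1 tr1.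
by apply/(mulgI a^-1); rewrite mulVg eh h1 morph1.
Qed.

End Injectivity.

(** * Lifting a level-preserving automorphism to the fundamental group *)
Section FlagLift.
Variables (N : nagao_data) (S : splitting N).
Local Notation X := (nagao_ray N).
Local Notation Gamma := (pi1 X).

Lemma adj_level (v w : bs_vertex X) :
  bs_adj v w -> level w = (level v).+1 ->
  exists x, v = bs_vert (level v) x /\ w = bs_vert (level v).+1 x.
Proof.
move=> [i [x [[-> ->]|[-> ->]]]] /= e; first by exists x.
by have := ltn_trans (ltnSn i) (ltnSn i.+1); rewrite -e ltnn.
Qed.

(** The edge from x_0 to x_1 goes to an edge z with ends of levels 0 and 1, and
    above it the flag is determined, since a vertex of positive level has a
    single neighbour on the next level. *)
Lemma flag_lift (g : gaut (bs_tree X)) (x : Gamma) : level_preserving X g ->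
  exists z, forall i, g (bs_vert i x) = bs_vert i z.
Proof.
move=> lg.
have adjg i : bs_adj (g (bs_vert i x)) (g (bs_vert i.+1 x)).
  by apply/(aut_adj g); exists i, x; left.
have lev i : level (g (bs_vert i.+1 x)) = (level (g (bs_vert i x))).+1.
  by rewrite !lg.
have [z [z0 z1]] := adj_level (adjg 0) (lev 0).
rewrite !lg /= in z0 z1.
exists z; case=> // i; elim: i => // i IH.
have [y [y0 y1]] := adj_level (adjg i.+1) (lev i.+1).
rewrite !lg /= in y0 y1; rewrite y1.
move: y0; rewrite IH => /bs_vert_eq[a ->].
have -> : vmap a = @vmap X i.+2 (Gam_up N i a) by exact: esym (@vmap_up N i a).
by rewrite bs_vert_mulr.
Qed.

(** A flag only determines its lift up to H_0. This freedom is spent to make [lg]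
    commute with right translations by H_0 and, inside each coset of
    Gamma_(n+1), preserve the H_0-part [kap] of the coordinates. To this end
    the points with trivial H_0-part relative to a base point [rep x] of the
    coset are lifted first, their lifts are corrected by H_0 to get a trivial
    H_0-part relative to [fl (rep x)], and the result is extended by
    H_0-equivariance. *)
Lemma adapted_lift n (g : gaut (bs_tree X)) : level_preserving X g ->
  exists lg : Gamma -> Gamma,
  [/\ forall i x, g (bs_vert i x) = bs_vert i (lg x),
      forall x h, lg (x * vmap0 (H0_in0 N h)) = lg x * vmap0 (H0_in0 N h) &
      forall x (a b : Gam N n.+1), lg (x * vmapS a) = lg x * vmapS b -> kap S b = kap S a].
Proof.
move=> lg.
pose fl x := sval (cid (flag_lift x lg)).
have flE i x : g (bs_vert i x) = bs_vert i (fl x) by exact: svalP (cid (flag_lift x lg)) i.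
pose rep x : Gamma := sval (cid (vcosetP (bs_vert n.+1 x))).
have repJ x (a : Gam N n.+1) : rep (x * vmapS a) = rep x by rewrite /rep [bs_vert _ _]bs_vert_mulr.
have repE x : bs_vert n.+1 (rep x) = bs_vert n.+1 x.
  by apply: bs_vertex_ext => //=; rewrite -(svalP (cid (vcosetP (bs_vert n.+1 x)))).
have mmE x : exists m : Gam N n.+1, x = rep x * vmapS m by have /bs_vert_eq[a e] := repE x; exists a.
pose mm x := sval (cid (mmE x)).
have mmP x : x = rep x * vmapS (mm x) by exact: svalP (cid (mmE x)).
have mmJ x a : mm (x * vmapS a) = mm x * a.
  apply: (vmapS_inj S); apply: (mulgI (rep x)); rewrite -{1}(repJ x a) -mmP.
  by rewrite vmapSM mulgA -mmP.
have bbE x : exists b : Gam N n.+1, fl x = fl (rep x) * vmapS b.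
  by have /bs_vert_eq[a e] : bs_vert n.+1 (fl (rep x)) = bs_vert n.+1 (fl x);
    [rewrite -!flE repE | exists a].
pose bb x := sval (cid (bbE x)).
have bbP x : fl x = fl (rep x) * vmapS (bb x) by exact: svalP (cid (bbE x)).
pose k x := H0M S n (kap S (mm x)).
pose x1 x := x * vmapS (k x)^-1.
pose mu x := bb (x1 x) * (H0M S n (kap S (bb (x1 x))))^-1 * k x.
pose lf x := fl (rep x) * vmapS (mu x).
have kapV (a : Gam N n.+1) : kap S a^-1 = (kap S a)^-1.
  by apply: (mulgI (kap S a)); rewrite -kapM !mulgV kap1.
have kmu x : kap S (mu x) = kap S (mm x).
  by rewrite /mu /k !kapM kapV !kapH0M mulgV mul1g.
exists lf; split.
- move=> i x.
  have fx h y : bs_vert i (y * vmapS (H0M S n h)) = bs_vert i y.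
    rewrite vmapH0M; case: i => [|i]; first exact: bs_vert_mulr.
    by rewrite -(vmapH0M S i h); exact: bs_vert_mulr.
  have kV a : (H0M S n a)^-1 = H0M S n a^-1.
    by apply: (mulgI (H0M S n a)); rewrite -H0M_M !mulgV /H0M morph1 tr1.
  rewrite /lf /mu !vmapSM !mulgA fx kV fx -[fl (rep x)](_ : fl (rep (x1 x)) = _) -?bbP.
    by rewrite -flE /x1 /k kV fx.
  by rewrite /x1 repJ.
- move=> x h; rewrite -(vmapH0M S n h) /lf repJ -mulgA -vmapSM; congr (_ * vmapS _).
  have kJ : k (x * vmapS (H0M S n h)) = k x * H0M S n h.
    by rewrite /k mmJ kapM kapH0M H0M_M.
  have x1J : x1 (x * vmapS (H0M S n h)) = x1 x.
    by rewrite /x1 kJ invMg vmapSM !vmapSV mulgA mulgK.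
  by rewrite /mu x1J kJ !mulgA.
- move=> x a b; rewrite /lf repJ -mulgA -vmapSM => /(mulgI (fl (rep x)))/(vmapS_inj S).
  move=> /(congr1 (@kap N S n)); rewrite kapM !kmu mmJ kapM.
  by move=> /(mulgI (kap S (mm x))).
Qed.

End FlagLift.

(** * Extending finite pieces of local data *)

(** Local data for a single vertex group K: on the image of [P] they are read off
    [lg], elsewhere they are the identity. The last clause records this
    dichotomy, through which properties of [lg] pass to the cocycle. *)
Lemma prescribed_cocycle (Gamma : groupType) (H K : finGroupType) (j : H -> K)
    (e : K -> Gamma) (lg : Gamma -> Gamma) (Q : finType) (act : Q -> H -> Q)
    (P : set Gamma) (iota : Gamma -> Q) :
  {morph j : x y / x * y} -> injective j ->
  {morph e : x y / x * y} -> injective e ->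
  right_action act -> free_action act -> #|K| %| #|Q| ->
  (forall x a, P x -> P (x * e a)) -> {in P &, injective iota} ->
  (forall x h, P x -> act (iota x) h = iota (x * e (j h))) ->
  (forall x a, exists b, lg (x * e a) = lg x * e b) ->
  (forall x a b, lg (x * e a) = lg (x * e b) -> a = b) ->
  (forall x h, lg (x * e (j h)) = lg x * e (j h)) ->
  exists c : cocycle K Q,
    [/\ forall q h, cact c q (j h) = act q h,
        forall q h, cval c q (j h) = j h,
        forall x a, P x -> cact c (iota x) a = iota (x * e a),
        forall x a, P x -> lg (x * e a) = lg x * e (cval c (iota x) a) &
        forall q a, cval c q a = a \/ exists x, lg (x * e a) = lg x * e (cval c q a)].
Proof.
move=> jM jI eM eI ra fa dQ PM iotaI act_iota lgE lgI lgH.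
have e1 : e 1 = 1 by apply: (mulgI (e 1)); rewrite -eM !mulg1.
pose isP q := `[< exists2 x, P x & iota x = q >].
pose dec q := xget 1 [set x | P x /\ iota x = q].
have decP q : isP q -> P (dec q) /\ iota (dec q) = q.
  by move=> /asboolP[x Px xq]; apply: (@xgetPex _ 1 [set x | P x /\ iota x = q]); exists x.
have isP_iota x : P x -> isP (iota x) by move=> Px; apply/asboolP; exists x.
have dec_iota x : P x -> dec (iota x) = x.
  by move=> Px; have [Pd ed] := decP _ (isP_iota _ Px); apply: iotaI; rewrite ?inE.
pose pact q a := iota (dec q * e a).
have [|||||actK [raK actKj actKP actKN]] :=
  @free_action_complete H K j Q act isP pact jM jI ra fa dQ.
- by move=> q a /decP[Pq _]; apply: isP_iota; exact: PM.
- by move=> q /decP[_ eq]; rewrite /pact e1 mulg1.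
- move=> q a b /decP[Pq _]; rewrite /pact eM mulgA dec_iota //; exact: PM.
- move=> q a /[dup] Dq /decP[Pq eq]; rewrite /pact -{2}eq => /iotaI h.
  apply: eI; rewrite e1; apply: (mulgI (dec q)); rewrite mulg1.
  by apply: h; rewrite inE//; exact: PM.
- by move=> q h /decP[Pq eq]; rewrite /pact -act_iota // eq.
pose val x a := sval (cid (lgE x a)).
have valP x a : lg (x * e a) = lg x * e (val x a) by exact: svalP (cid (lgE x a)).
pose s q a := if isP q then val (dec q) a else a.
have sI q : injective (s q).
  rewrite /s; case: (isP q) => // a b ab; apply: (lgI (dec q)).
  by rewrite !valP ab.
have siE q : exists f, cancel (s q) f /\ cancel f (s q).
  by have [f fK Kf] := injF_bij (@sI q); exists f.
pose si q := sval (cid (siE q)).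
have siK q : cancel (s q) (si q) /\ cancel (si q) (s q) by exact: svalP (cid (siE q)).
have sM q a b : s q (a * b) = s q a * s (actK q a) b.
  rewrite /s; case Dq: (isP q); last by rewrite (negPf (actKN q a _)) // Dq.
  have [Pq eq] := decP _ Dq; rewrite actKP // /pact isP_iota; last exact: PM.
  rewrite dec_iota; last exact: PM.
  by apply: eI; apply: (mulgI (lg (dec q))); rewrite -valP !eM !mulgA -!valP.
exists (@Cocycle K Q actK s si raK (fun q => (siK q).1) (fun q => (siK q).2) sM).
split=> //=.
- move=> q h; rewrite /s; case: (isP q) => //.
  by apply: eI; apply: (mulgI (lg (dec q))); rewrite -valP lgH.
- by move=> x a Px; rewrite actKP ?isP_iota // /pact dec_iota.
- by move=> x a Px; rewrite /s isP_iota // dec_iota // valP.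
- move=> q a; rewrite /s; case: (isP q); last by left.
  by right; exists (dec q); exact: valP.
Qed.

(** The set Q = P x 'I_m carries the H-action of its first factor, and m divides
    its cardinality. *)
Lemma finite_free_model (Gamma : groupType) (H : finGroupType) (e : H -> Gamma)
    (P : set Gamma) (x0 : Gamma) (m : nat) :
  {morph e : x y / x * y} -> injective e -> finite_set P -> P x0 -> 0 < m ->
  (forall x h, P x -> P (x * e h)) ->
  exists (Q : finType) (act : Q -> H -> Q) (iota : Gamma -> Q),
    [/\ right_action act, free_action act, m %| #|Q|,
        {in P &, injective iota} &
        forall x h, P x -> act (iota x) h = iota (x * e h)].
Proof.
move=> eM eI /finite_fsetP[F ->] /= Fx0 m0 PM.
have e1 : e 1 = 1 by apply: (mulgI (e 1)); rewrite -eM !mulg1.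
case: m m0 => // m _.
pose act (q : F * 'I_m.+1) h : F * 'I_m.+1 := (insubd [` Fx0]%fset (val q.1 * e h), q.2).
have inF (x : F) h : val (insubd [` Fx0]%fset (val x * e h)) = val x * e h.
  by rewrite val_insubd PM // fsvalP.
exists (F * 'I_m.+1)%type, act, (fun x => (insubd [` Fx0]%fset x, ord0)); split.
- split=> [[x i]|[x i] h k]; rewrite /act /=; congr pair; apply: val_inj.
    by rewrite inF e1 mulg1.
  by rewrite !inF eM mulgA.
- move=> [x i] h [/(congr1 val)]; rewrite inF => /(congr1 (fun y => (val x)^-1 * y)).
  by rewrite mulKg mulVg -e1 => /eI.
- by rewrite card_prod card_ord dvdn_mull.
- move=> x y; rewrite !inE => Fx Fy [] /(congr1 val).
  by rewrite !val_insubd Fx Fy.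
- move=> x h Fx; rewrite /act /=; congr (insubd _ _, _).
  by rewrite val_insubd Fx.
Qed.

Section Approximation.
Variables (N : nagao_data) (S : splitting N).
Local Notation X := (nagao_ray N).
Local Notation Gamma := (pi1 X).

(** The points of [A] saturated under Gamma_0, respectively under Gamma_(n+1),
    form the domains where the data of the two groups are prescribed by [lg].
    The injectivity of [lg] on cosets rests on [vmap_meet]: two points of a
    coset with the same flag differ by H_0, for which [lg] is equivariant. *)
Lemma tree_cocycle_of_lift n (g : gaut (bs_tree X)) (lg : Gamma -> Gamma) (A : set Gamma) :
  (forall i x, g (bs_vert i x) = bs_vert i (lg x)) ->
  (forall x h, lg (x * vmap0 (H0_in0 N h)) = lg x * vmap0 (H0_in0 N h)) ->
  (forall x (a b : Gam N n.+1), lg (x * vmapS a) = lg x * vmapS b -> kap S b = kap S a) ->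
  finite_set A -> A 1 ->
  exists (Q : finType) (c : tree_cocycle S n Q) (iota : Gamma -> Q),
  [/\ forall x b, A x -> cact (tc0 c) (iota x) b = iota (x * vmap0 b),
      forall x b, A x -> lg (x * vmap0 b) = lg x * vmap0 (cval (tc0 c) (iota x) b),
      forall x a, A x -> cact (tc1 c) (iota x) a = iota (x * vmapS a) &
      forall x a, A x -> lg (x * vmapS a) = lg x * vmapS (cval (tc1 c) (iota x) a)].
Proof.
move=> gE lgH lgK finA A1.
have vI := @vmapS_inj N S; have v0I := vmap0_inj S.
have g_inj u w : g u = g w -> u = w by exact: can_inj (aut_funK g) u w.
have lg_coset i x y : bs_vert i (lg x) = bs_vert i (lg y) -> bs_vert i x = bs_vert i y.
  by rewrite -!gE => /g_inj.
have in0M : {morph H0_in0 N : x y / x * y} by move=> x y; rewrite morphM ?inE.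
have in0I := @H0_in0_injective N.
pose eta h := vmap0 (H0_in0 N h).
have etaM : {morph eta : x y / x * y} by move=> x y; rewrite /eta in0M vmap0M.
have etaI : injective eta by move=> x y /v0I/in0I.
have etaS h : vmapS (H0M S n h) = eta h by exact: vmapH0M.
have lift0 x b : exists b', lg (x * vmap0 b) = lg x * vmap0 b'.
  have /bs_vert_eq[b' ->] : bs_vert 0 (lg x) = bs_vert 0 (lg (x * vmap0 b)).
    by rewrite -!gE [bs_vert _ (_ * _)]bs_vert_mulr.
  by exists b'.
have liftS x (a : Gam N n.+1) : exists a' : Gam N n.+1, lg (x * vmapS a) = lg x * vmapS a'.
  have /bs_vert_eq[b' ->] : bs_vert n.+1 (lg x) = bs_vert n.+1 (lg (x * vmapS a)).
    by rewrite -!gE [bs_vert _ (_ * _)]bs_vert_mulr.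
  by exists b'.
have lg_inj x h : lg (x * eta h) = lg x -> h = 1.
  rewrite lgH -[RHS]mulg1 => /mulgI; rewrite -(vmap01 N) -(morph1 (H0_in0 N)).
  exact: etaI.
have inj0 x a b : lg (x * vmap0 a) = lg (x * vmap0 b) -> a = b.
  move=> eab; have /lg_coset/bs_vert_eq[m em] :
    bs_vert n.+1 (lg (x * vmap0 b)) = bs_vert n.+1 (lg (x * vmap0 a)) by rewrite eab.
  have : vmapS m = vmap0 (b^-1 * a).
    rewrite vmap0M; apply: (mulgI (x * vmap0 b)); rewrite -em -mulgA (mulgA (vmap0 b)) -vmap0M.
    by rewrite mulgV vmap01 mul1g.
  move=> /(vmap_meet S)[h [_ eh]].
  have eta_a : x * vmap0 a = x * vmap0 b * eta h by rewrite /eta -eh -mulgA -vmap0M mulKVg.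
  have h1 : h = 1 by apply: (lg_inj (x * vmap0 b)); rewrite -eta_a.
  by apply: (mulgI b^-1); rewrite eh h1 morph1 mulVg.
have injS x (a b : Gam N n.+1) : lg (x * vmapS a) = lg (x * vmapS b) -> a = b.
  move=> eab; have /lg_coset/bs_vert_eq[m em] :
    bs_vert 0 (lg (x * vmapS b)) = bs_vert 0 (lg (x * vmapS a)) by rewrite eab.
  have : vmapS (b^-1 * a) = vmap0 m.
    rewrite vmapSM; apply: (mulgI (x * vmapS b)); rewrite -[RHS]em -mulgA (mulgA (vmapS b)) -vmapSM.
    by rewrite mulgV vmapS1 mul1g.
  move=> /(vmap_meet S)[h [eh _]].
  have eta_a : x * vmapS a = x * vmapS b * eta h by rewrite -etaS -eh -mulgA -vmapSM mulKVg.
  have h1 : h = 1 by apply: (lg_inj (x * vmapS b)); rewrite -eta_a.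
  by apply: (mulgI b^-1); rewrite eh h1 /H0M morph1 tr1 mulVg.
pose P0 := \bigcup_(x in A) [set x * vmap0 b | b in [set: Gam N 0]].
pose PS := \bigcup_(x in A) [set x * vmapS a | a in [set: Gam N n.+1]].
have P0M x b : P0 x -> P0 (x * vmap0 b).
  by move=> [y Ay [b' _ <-]]; exists y => //; exists (b' * b); rewrite // vmap0M mulgA.
have PSM x (a : Gam N n.+1) : PS x -> PS (x * vmapS a).
  by move=> [y Ay [b' _ <-]]; exists y => //; exists (b' * a); rewrite // vmapSM mulgA.
have A0 x : A x -> P0 x by move=> Ax; exists x => //; exists 1; rewrite // vmap01 mulg1.
have AS x : A x -> PS x by move=> Ax; exists x => //; exists 1; rewrite // vmapS1 mulg1.
have finP : finite_set (P0 `|` PS).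
  by rewrite finite_setU; split; apply: bigcup_finite => // x _; apply: finite_image;
    exact: finite_finset.
have PM x h : (P0 `|` PS) x -> (P0 `|` PS) (x * eta h).
  by move=> [Px|Px]; [left; exact: P0M|right; rewrite -etaS; exact: PSM].
have [||Q [act [iota [ra fa dQ iotaI act_iota]]]] :=
  @finite_free_model Gamma (H0 N) eta (P0 `|` PS) 1 (#|Gam N 0| * #|Gam N n.+1|)
    etaM etaI finP _ _ PM.
- by left; exact: A0.
- by rewrite muln_gt0 -!cardsT !cardG_gt0.
have dQ0 : #|Gam N 0| %| #|Q| by apply: dvdn_trans dQ; rewrite dvdn_mulr.
have dQS : #|Gam N n.+1| %| #|Q| by apply: dvdn_trans dQ; rewrite dvdn_mull.
have [||c0 [c0act c0val c0P c0lg _]] := @prescribed_cocycle Gamma (H0 N) (Gam N 0)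
  (H0_in0 N) (@vmap0 N) lg Q act P0 iota in0M in0I (@vmap0M N) v0I ra fa dQ0 P0M
  _ _ lift0 inj0 lgH.
- by move=> x y; rewrite !inE => Px Py; apply: iotaI; rewrite inE; left.
- by move=> x h Px; apply: act_iota; left.
have [|||cS [cSact cSval cSP cSlg cSE]] := @prescribed_cocycle Gamma (H0 N) (Gam N n.+1)
  (H0M S n) (@vmapS N n) lg Q act PS iota (@H0M_M N S n) (@H0M_inj N S n) (@vmapSM N n)
  (vI n) ra fa dQS PSM _ _ liftS injS _.
- by move=> x y; rewrite !inE => Px Py; apply: iotaI; rewrite inE; right.
- by move=> x h Px; rewrite etaS; apply: act_iota; right.
- by move=> x h; rewrite etaS lgH.
have c_act q h : cact c0 q (H0_in0 N h) = cact cS q (H0M S n h) by rewrite c0act cSact.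
have c_kap q a : kap S (cval cS q a) = kap S a.
  by have [->//|[x /lgK]] := cSE q a.
have lev i x (a b : Gam N n.+1) : i <= n -> lg (x * vmapS a) = lg x * vmapS b ->
    (exists a' : Gam N i.+1, a = tr S n a') <-> (exists b' : Gam N i.+1, b = tr S n b').
  move=> lein eab; split=> [[a' ea]|[b' eb]].
    have : bs_vert i.+1 (lg x) = bs_vert i.+1 (lg (x * vmapS a)).
      by rewrite -!gE ea vmap_tr // [bs_vert _ (_ * _)]bs_vert_mulr.
    rewrite eab => /bs_vert_eq[b' /mulgI eb]; exists b'; apply: (vI n).
    by rewrite eb vmap_tr.
  have /lg_coset/bs_vert_eq[a' /mulgI ea] :
      bs_vert i.+1 (lg x) = bs_vert i.+1 (lg (x * vmapS a)).
    by rewrite eab eb vmap_tr // [RHS]bs_vert_mulr.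
  by exists a'; apply: (vI n); rewrite ea vmap_tr.
have c_lev i q (a : Gam N i.+1) : i <= n ->
    exists a' : Gam N i.+1, cval cS q (tr S n a) = tr S n a'.
  move=> lein; have [->|[x /(lev i) h]] := cSE q (tr S n a); first by exists a.
  by apply/h => //; exists a.
have c_levV i q (a : Gam N i.+1) : i <= n ->
    exists a' : Gam N i.+1, cinv cS q (tr S n a) = tr S n a'.
  move=> lein; have := cSE q (cinv cS q (tr S n a)); rewrite cinvK.
  move=> [<-|[x /(lev i) h]]; first by exists a.
  by apply/h => //; exists a.
exists Q, (@TreeCocycle N S n Q c0 cS c_act c0val cSval c_kap c_lev c_levV), iota.
split=> x a Ax /=; [exact/c0P/A0|exact/c0lg/A0|exact/cSP/AS|exact/cSlg/AS].
Qed.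

(** Along the finite subtree, starting at the base vertex, the developed map and
    the lift [lg] of g obey the same recursion, hence coincide on all the cosets
    that are vertices of the subtree. *)
Lemma level_preserving_approx (g : gaut (bs_tree X)) (F : set (bs_tree X)) :
  level_preserving X g -> finite_subtree F ->
  exists h, [/\ level_preserving X h, commensurator (lattice X) h &
                forall v, F v -> h v = g v].
Proof.
move=> lg finF.
have [F0 [finF0 F0x _]] := @path_finite_subtree (bs_tree X) (bs_vert 0 1) (bs_vert 0 1).
have [E [_ finE conE] FE] := finite_subtreeU finF finF0.
have E1 : E (bs_vert 0 1) by apply: FE; right.
have [n En] : exists n, forall v, E v -> level v <= n.+1.
  have /finite_seqP[s es] : finite_set (@level X @` E) by exact: finite_image.
  exists (\max_(i <- s) i) => v Ev; apply: leqW; apply: leq_bigmax_seq => //.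
  have lv : (@level X @` E) (level v) by exists v.
  by move: lv; rewrite es.
have [gh [ghE ghH ghK]] := adapted_lift S n lg.
pose A := \bigcup_(v in E) @vcoset X v.
have finA : finite_set A.
  apply: bigcup_finite => // v _; have [x ->] := vcosetP v.
  by apply: finite_image; exact: finite_finset.
have A1 : A 1 by exists (bs_vert 0 1) => //; exists 1; rewrite // vmap1 mulg1.
have [Q [c [iota [c0 l0 cS lS]]]] := tree_cocycle_of_lift ghE ghH ghK finA A1.
have [h [hl hc hE]] := cocycle_commensurates c (iota 1) (gh 1).
exists h; split=> //.
pose good x := ptact c (iota 1) x = iota x /\ gh 1 * dev c (iota 1) x = gh x.
have goodM i z (a : vgrp X i) : E (bs_vert i z) -> good z -> good (z * vmap a).
  move=> Ev [z1 z2]; have Az : A z.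
    by exists (bs_vert i z) => //; exists 1; rewrite // vmap1 mulg1.
  rewrite /good (proj2 (ptactP c)) devM z1 mulgA z2.
  case: i a Ev => [|i] a Ev.
    by rewrite ptact0 dev0 c0 // -l0.
  have lein : i <= n by have := En _ Ev.
  rewrite -[@vmap X i.+1 a]/(@vmapS N i a) ptactS dev_low // cS // -lS //.
  by rewrite vmap_tr.
have good_vert i z : E (bs_vert i z) -> good z -> forall x, vcoset (bs_vert i z) x -> good x.
  by move=> Ev gz _ [a _ <-]; exact: goodM.
have good1 : good 1 by rewrite /good (proj1 (ptactP c)) dev1 mulg1.
have allgood v : E v -> forall x, vcoset v x -> good x.
  move=> Ev.
  suff : (forall x, vcoset (bs_vert 0 1 : bs_vertex X) x -> good x) -> forall x, vcoset v x -> good x.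
    by apply; exact: good_vert.
  elim: (conE _ _ E1 Ev) => // [u w [Eu Ew [i [z uw]]]|u v1 w _ IH1 _ IH2 gu]; last first.
    exact/IH2/IH1.
  have zi k : vcoset (bs_vert k z) z by exists 1; rewrite // vmap1 mulg1.
  by case: uw Eu Ew => [[-> ->]|[-> ->]] Eu Ew gu; apply: good_vert => //; apply: gu.
move=> v Fv; have Ev : E v by apply: FE; left.
have [x vx] := bs_vertexE v; rewrite vx hE ghE.
have [|_ ->//] := allgood v Ev x.
by rewrite vx; exists 1; rewrite // vmap1 mulg1.
Qed.

End Approximation.

Theorem theorem4 (N : nagao_data) (hN : directly_split N) :
  let X := nagao_ray N in
  dense_in (commensurator (lattice X) `&` level_preserving X)
           (level_preserving X).
Proof.
move=> X; split=> [g []//|g lg B [F finF FB]].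
have [S] := directly_split_splitting hN.
have [h [hl hc hg]] := level_preserving_approx S lg finF.
exists h; split; first by [].
apply: FB; exists (g^-1 * h); last by rewrite mulKVg.
by move=> v Fv; have := hg v Fv => e; rewrite /= e aut_funK.
Qed.
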